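(* Let $1\le p_1,p_2\le\infty$ and $0<p_3\le\infty$. If there exists a non-zero continuous and integrable function $M$ belonging to $\tilde{\mathcal M}_{(p_1,p_2,p_3)}(\mathbb R)$, then $$\frac1{p_3}\le\frac1{p_1}+\frac1{p_2}\le\frac1{p_3}+1.$$
   Context: The Fourier transform is $\hat f(\xi)=\int_{\mathbb R}f(x)e^{-2\pi i x\xi}dx$. $\mathcal P(\mathbb R)$ denotes the set of Schwartz functions on $\mathbb R$ whose Fourier transform is continuous with compact support. $\tilde{\mathcal M}_{(p_1,p_2,p_3)}(\mathbb R)$ is the space of measurable (locally integrable) $M:\mathbb R\to\mathbb C$ such that the bilinear operator $B_M(f,g)(x)=\int_{\mathbb R}\int_{\mathbb R}\hat f(\xi)\hat g(\eta)M(\xi-\eta)e^{2\pi i(\xi+\eta)x}d\xi\,d\eta$, $f,g\in\mathcal P(\mathbb R)$, satisfies $\|B_M(f,g)\|_{p_3}\le C\|f\|_{p_1}\|g\|_{p_2}$ for some $C$ and all $f,g\in\mathcal P(\mathbb R)$. *)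

(* Defs.v *)
From HB Require Import structures.
From mathcomp Require Import all_boot all_order all_algebra.
From mathcomp Require Import all_classical all_reals all_analysis.
From mathcomp Require Export complex.
Import numFieldNormedType.Exports.
Set Implicit Arguments. Unset Strict Implicit. Unset Printing Implicit Defensive.
Import Order.TTheory GRing.Theory Num.Theory.
Local Open Scope classical_set_scope.
Local Open Scope ring_scope.

Section Defs.
Variable R : realType.
Local Notation C := R[i].
Local Notation leb := (@lebesgue_measure R).

Definition cmod (z : C) : R := Num.sqrt (complex.Re z ^+ 2 + complex.Im z ^+ 2).

Definition expi (t : R) : C := Complex (cos t) (sin t).

Definition cint (f : R -> C) : C :=
  Complex (Rintegral leb setT (fun x => complex.Re (f x)))
          (Rintegral leb setT (fun x => complex.Im (f x))).

Definition cintegrable (f : R -> C) : Prop :=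
  measurable_fun setT (fun x => complex.Re (f x)) /\
  measurable_fun setT (fun x => complex.Im (f x)) /\
  (\int[leb]_x (cmod (f x))%:E < +oo)%E.

Definition loc_integrable (f : R -> C) : Prop :=
  measurable_fun setT (fun x => complex.Re (f x)) /\
  measurable_fun setT (fun x => complex.Im (f x)) /\
  forall a b : R, (\int[leb]_(x in `[a, b]) (cmod (f x))%:E < +oo)%E.

Definition ccontinuous (f : R -> C) : Prop :=
  continuous (fun x : R => complex.Re (f x)) /\ continuous (fun x : R => complex.Im (f x)).

Definition fourier (f : R -> C) (xi : R) : C :=
  cint (fun x => f x * expi (- (2 * pi * x * xi))).

Definition schwartz (f : R -> C) : Prop :=
  forall b : nat,
    (forall x, derivable (iter b (fun h : R -> R => derive1 h) (fun t => complex.Re (f t))) x (1:R) /\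
               derivable (iter b (fun h : R -> R => derive1 h) (fun t => complex.Im (f t))) x 1) /\
    forall a : nat, exists K : R, forall x,
      `|x| ^+ a * `|iter b (fun h : R -> R => derive1 h) (fun t => complex.Re (f t)) x| <= K /\
      `|x| ^+ a * `|iter b (fun h : R -> R => derive1 h) (fun t => complex.Im (f t)) x| <= K.

Definition classP (f : R -> C) : Prop :=
  schwartz f /\ ccontinuous (fourier f) /\
  exists K : R, forall xi, K < `|xi| -> fourier f xi = 0.

Definition Lpnorm (p : \bar R) (f : R -> C) : \bar R :=
  Lnorm leb p (fun x => (cmod (f x))%:E).

Definition BM (M : R -> C) (f g : R -> C) (x : R) : C :=
  cint (fun eta => cint (fun xi =>
    fourier f xi * fourier g eta * M (xi - eta) * expi (2 * pi * (xi + eta) * x))).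

Definition tildeM (p1 p2 p3 : \bar R) (M : R -> C) : Prop :=
  loc_integrable M /\
  exists K : R, forall f g : R -> C, classP f -> classP g ->
    (Lpnorm p3 (BM M f g) <= K%:E * Lpnorm p1 f * Lpnorm p2 g)%E.

Definition einv (p : \bar R) : R :=
  match p with r%:E => r^-1 | _ => 0 end.

End Defs.

(* Main.v *)
(** A packet of scale [t], frequency [a] and position [s] is the inverse Fourier
    transform of [bump (t (xi - a)) e^(-2 pi i s xi)]; its [L^p] norm is
    [O (t^(1/p - 1))].  Both inequalities come from testing [B_M] on packets [f] at
    [(a, s)] and [g] at [(-a, -s)], which replaces [M(u)] by [M(u) e^(-2 pi i s u)].

    As [t -> oo] the frequencies concentrate at [(a, -a)], so [|B_M (f, g)|] is
    at least of order [|M (2 a)| t^(-2)] on an interval of length of order [t].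
    This gives [t^(1/p3) <= C t^(1/p1 + 1/p2)] for large [t].

    As [t -> 0] the symbol, seen at frequency scale [1 / t], acts like [m] times a
    point mass on the diagonal, with [m] the integral of [M(u) e^(-2 pi i s u)], and
    [|B_M (f, g)|] is at least of order [|m| t^(-1)] on an interval of length of
    order [t].  This gives [t^(1 + 1/p3) <= C t^(1/p1 + 1/p2)] for small [t].  By
    injectivity of the Fourier transform on continuous integrable functions,
    [m <> 0] for some [s].

    The Fourier transforms of the packets are computed with Fourier inversion
    for test functions, by Abel summation against [e^(-|x| / n)]. *)

Require Import Defs.
From HB Require Import structures.
From mathcomp Require Import all_boot all_order all_algebra.
From mathcomp Require Import all_classical all_reals all_analysis.
From mathcomp Require Import measurable_realfun ess_sup_inf.
From mathcomp Require Import complex.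
From mathcomp Require Import ring lra.
Import numFieldNormedType.Exports.
Import Order.TTheory GRing.Theory Num.Theory.
Set Implicit Arguments. Unset Strict Implicit. Unset Printing Implicit Defensive.
Local Open Scope classical_set_scope.
Local Open Scope ring_scope.

(** * Integrals on the line and on the plane *)
Section Toolkit.
Variable R : realType.
Local Notation leb := (@lebesgue_measure R).
Local Notation rint f := (Rintegral leb setT f).
Local Notation integ f := (leb.-integrable setT (EFin \o f)).
Implicit Types (f g h u v : R -> R).

(** Opposite frequencies centre the output frequency [xi + eta] at 0 with spread [2 / t]. On
    [|x| <= rho t] the factor [e^(2 pi i (xi + eta) x)] is then close to 1, so it cannot cause
    cancellation; this fixes the length of the interval.

    Lower bounds for complex integrals come from pairing with the conjugate of the expected limit.
    The question becomes one of pointwise minorants for real integrands, where the limit contributes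
    its squared modulus and all errors are small fractions of it.

    At small scale [M] is only integrable, so replacing one bump by the other on the diagonal has an
    error without a rate. Dominated convergence controls it, which is why the scale there runs
    through [1 / (n + 1)] and why exponents are compared along integers.

    Packets are prescribed on the Fourier side because class P asks for compactly supported
    transforms. In space they are known only through cosine and sine transforms, whose decay
    [1 / (1 + x^2)] suffices for every [p >= 1]. *)

Lemma integ_measurable f : integ f -> measurable_fun setT f.
Proof. by move=> /(measurable_int leb)/measurable_EFinP. Qed.

Lemma eq_integ f g : f =1 g -> integ f -> integ g.
Proof. by move=> /funext ->. Qed.

Lemma integD f g : integ f -> integ g -> integ (fun x => f x + g x).
Proof. by move=> mf mg; apply: (integrableD measurableT mf mg). Qed.

Lemma integZ (k : R) f : integ f -> integ (fun x => k * f x).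
Proof. by move=> mf; apply: (integrableZl measurableT k mf). Qed.

Lemma integB f g : integ f -> integ g -> integ (fun x => f x - g x).
Proof. by move=> mf mg; apply: (integrableB measurableT mf mg). Qed.

Lemma integ_le f g : measurable_fun setT f -> integ g ->
  (forall x, `|f x| <= g x) -> integ f.
Proof.
move=> mf ig fg; apply: (@le_integrable _ _ _ leb setT measurableT _ (EFin \o g)) => //.
  exact/measurable_EFinP.
move=> x _ /=; rewrite lee_fin (le_trans (fg x))// ler_norm//.
Qed.

Lemma integ_norm f : integ f -> integ (fun x => `|f x|).
Proof. by move=> mf; apply: (integrable_norm mf). Qed.

Lemma eq_rint f g : f =1 g -> rint f = rint g.
Proof. by move=> /funext ->. Qed.

Lemma rintD f g : integ f -> integ g ->
  rint (fun x => f x + g x) = rint f + rint g.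
Proof. by move=> ? ?; rewrite RintegralD. Qed.

Lemma rintB f g : integ f -> integ g ->
  rint (fun x => f x - g x) = rint f - rint g.
Proof. by move=> ? ?; rewrite RintegralB. Qed.

Lemma rintZ (k : R) f : integ f -> rint (fun x => k * f x) = k * rint f.
Proof. by move=> ?; rewrite RintegralZl. Qed.

Lemma le_rint f g : integ f -> integ g -> (forall x, f x <= g x) ->
  rint f <= rint g.
Proof. by move=> ? ? fg; apply: le_Rintegral. Qed.

Lemma le_norm_rint f : integ f -> `|rint f| <= rint (fun x => `|f x|).
Proof. by move=> ?; apply: le_normr_Rintegral. Qed.

Lemma EFin_rint f : integ f -> (rint f)%:E = (\int[leb]_x (f x)%:E)%E.
Proof. by move=> mf; rewrite /Rintegral fineK//; apply: integrable_fin_num. Qed.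

(** * Affine changes of variable *)

Lemma measurable_affine (t b : R) : measurable_fun setT (fun x : R => t * x + b).
Proof. exact: measurable_funD. Qed.

(** The image of Lebesgue measure under the affine map, multiplied by [|t|], agrees with it on
    half-open intervals, and this determines the measure. The sign of [t] decides which end of the
    preimage is open. *)
Lemma lebesgue_affine (t b : R) : t != 0 -> forall A, measurable A ->
  leb A = (`|t|%:E * leb ((fun x : R => t * x + b)%R @^-1` A))%E.
Proof.
move=> t0; pose phi : measurableTypeR R -> measurableTypeR R := fun x : R => t * x + b.
have mphi : measurable_fun setT phi by exact: measurable_affine.
pose pf := measure_function_pushforward__canonical__measure_function_Measure leb mphi.
pose mu' := measure_function_mscale__canonical__measure_function_Measure (NngNum (normr_ge0 t)) pf.
have H : forall X, ocitv X -> leb X = mu' X.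
  move=> X /ocitvP [->|[[x y] /= xy ->]]; first by rewrite !measure0.
  rewrite /mu' /= /mscale /= /pushforward /=.
  have [tpos|tneg|/eqP] := ltgtP 0 t; last by rewrite eq_sym (negbTE t0).
  - have -> : phi @^-1` `]x, y] = `](x - b) / t, (y - b) / t]%classic.
      apply/seteqP; split => z; rewrite /phi /= !in_itv/= ltr_pdivrMr// ler_pdivlMr//;
      by rewrite ltrBlDr lerBrDr mulrC.
    rewrite !lebesgue_measure_itv/= !lte_fin ltr_pM2r ?invr_gt0// ltrD2r xy gtr0_norm//.
    rewrite -!EFinB -EFinM; congr EFin; field; exact: t0.
  - have -> : phi @^-1` `]x, y] = `[(y - b) / t, (x - b) / t[%classic.
      apply/seteqP; split => z; rewrite /phi /= !in_itv/= ltr_ndivlMr// ler_ndivrMr//;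
      by rewrite ltrBlDr lerBrDr mulrC andbC.
    rewrite !lebesgue_measure_itv/= !lte_fin ltr_nM2r ?invr_lt0// ltrD2r xy ltr0_norm//.
    rewrite -!EFinB -EFinM; congr EFin; field; exact: t0.
by move=> A mA; rewrite (lebesgue_measure_unique H).
Qed.

Lemma ge0_integral_affine (t b : R) (F : R -> \bar R) : t != 0 ->
  measurable_fun setT F -> (forall x, 0 <= F x)%E ->
  (\int[leb]_x F (t * x + b)%R = `|t|^-1%:E * \int[leb]_x F x)%E.
Proof.
move=> t0 mF F0; pose phi : measurableTypeR R -> measurableTypeR R := fun x : R => t * x + b.
have mphi : measurable_fun setT phi by exact: measurable_affine.
pose pf := measure_function_pushforward__canonical__measure_function_Measure leb mphi.
pose mu' := measure_function_mscale__canonical__measure_function_Measure (NngNum (normr_ge0 t)) pf.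
have -> : (\int[leb]_x F x = \int[mu']_x F x)%E.
  apply: eq_measure_integral => A mA _; exact: (lebesgue_affine b t0 mA).
rewrite (ge0_integral_mscale _ _ (NngNum (normr_ge0 t)))//.
rewrite ge0_integral_pushforward//= muleA -EFinM mulVf ?normr_eq0// mul1e.
by [].
Qed.

(** A positive finite factor fixes both infinities, so distributivity survives even at [+oo - +oo].
    The positive and negative parts of any measurable function can thus be rescaled together. *)
Lemma mule_gt0Br (k : R) (x y : \bar R) : 0 < k ->
  (k%:E * (x - y) = k%:E * x - k%:E * y)%E.
Proof.
move=> k0; have ke : (0 < k%:E)%E by rewrite lte_fin.
have [E1 E2] := (gt0_muley ke, gt0_muleNy ke).
case: x => [x||]; case: y => [y||].
- by rewrite -EFinB -!EFinM -EFinB mulrBr.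
- by change (k%:E * -oo = k%:E * x%:E - k%:E * +oo)%E; rewrite E1 E2 -EFinM.
- by change (k%:E * +oo = k%:E * x%:E - k%:E * -oo)%E; rewrite E1 E2 -EFinM.
- by change (k%:E * +oo = k%:E * +oo - k%:E * y%:E)%E; rewrite E1 -EFinM.
- by change (k%:E * -oo = k%:E * +oo - k%:E * +oo)%E; rewrite E1 E2.
- by change (k%:E * +oo = k%:E * +oo - k%:E * -oo)%E; rewrite E1 E2.
- by change (k%:E * -oo = k%:E * -oo - k%:E * y%:E)%E; rewrite E2 -EFinM.
- by change (k%:E * -oo = k%:E * -oo - k%:E * +oo)%E; rewrite E1 E2.
- by change (k%:E * -oo = k%:E * -oo - k%:E * -oo)%E; rewrite E2.
Qed.

Lemma integral_affine (t b : R) (F : R -> \bar R) : t != 0 ->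
  measurable_fun setT F ->
  (\int[leb]_x F (t * x + b)%R = `|t|^-1%:E * \int[leb]_x F x)%E.
Proof.
move=> t0 mF; rewrite integralE [in RHS]integralE.
have tp : (0 < `|t|^-1) by rewrite invr_gt0 normr_gt0.
have P1 := ge0_integral_affine b t0 (measurable_funepos mF) (@funepos_ge0 _ _ F).
have P2 := ge0_integral_affine b t0 (measurable_funeneg mF) (@funeneg_ge0 _ _ F).
have -> : (\int[leb]_x (fun x => F (t * x + b)%R)^\+ x =
   \int[leb]_x F^\+ (t * x + b)%R)%E.
  by apply: eq_integral => x _; rewrite !unlock.
have -> : (\int[leb]_x (fun x => F (t * x + b)%R)^\- x =
   \int[leb]_x F^\- (t * x + b)%R)%E.
  by apply: eq_integral => x _; rewrite !unlock.
rewrite P1 P2.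
by rewrite -mule_gt0Br.
Qed.

Lemma rint_affine (t b : R) f : t != 0 -> measurable_fun setT f ->
  rint (fun x => f (t * x + b)) = `|t|^-1 * rint f.
Proof.
move=> t0 mf; pose I := (\int[leb]_x (f x)%:E)%E.
have E : (\int[leb]_x (f (t * x + b))%:E = `|t|^-1%:E * I)%E.
  by apply: (@integral_affine t b (EFin \o f)) => //; exact/measurable_EFinP.
have tp : (0 < `|t|^-1) by rewrite invr_gt0 normr_gt0.
(* An infinite integral stays infinite after scaling, and [Rintegral] sends it to 0 on both
   sides. *)
rewrite /Rintegral E -/I; case: I {E} => [r||] //=.
  by rewrite mulry gtr0_sg// mul1e mulr0.
by rewrite mulrNy gtr0_sg// mul1e mulr0.
Qed.

Lemma integ_affine (t b : R) f : t != 0 -> integ f ->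
  integ (fun x => f (t * x + b)).
Proof.
move=> t0 /integrableP [mf fy]; apply/integrableP; split.
  apply/measurable_EFinP; apply: measurableT_comp; first exact/measurable_EFinP.
  exact: measurable_affine.
rewrite (@ge0_integral_affine t b (fun x => `|(EFin \o f) x|%E))//; last first.
  exact: measurableT_comp.
rewrite muleC; move: fy; have : (0 <= \int[leb]_x `|(EFin \o f) x|)%E by exact: integral_ge0.
by case: (\int[leb]_x _)%E => [r||] // _ _; rewrite -EFinM ltry.
Qed.

Lemma rint_shift (b : R) f : measurable_fun setT f ->
  rint (fun x => f (x + b)) = rint f.
Proof.
move=> mf; rewrite -[RHS]mul1r -[X in X * _]invr1 -[X in X^-1 * _]normr1.
rewrite -(@rint_affine 1 b)//.
by apply: eq_rint => x; rewrite mul1r.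
Qed.

Lemma integ_shift (b : R) f : integ f -> integ (fun x => f (x + b)).
Proof.
move=> mf; apply: eq_integ (@integ_affine 1 b f _ mf); last exact: oner_neq0.
by move=> x /=; rewrite mul1r.
Qed.

Lemma rint_odd f : measurable_fun setT f -> (forall x, f (- x) = - f x) ->
  integ f -> rint f = 0.
Proof.
move=> mf odd itf; have t0 : (-1 : R) != 0 by rewrite oppr_eq0 oner_neq0.
have := @rint_affine (-1) 0 f t0 mf.
rewrite normrN1 invr1 mul1r.
have -> : (fun x => f (-1 * x + 0)) = (fun x => - 1 * f x).
  by apply/funext => x; rewrite addr0 !mulN1r odd.
rewrite rintZ// => H; lra.
Qed.

(** * Fubini on the plane *)

Lemma product_integ_section (J : R * R -> R) :
  (leb \x leb)%E.-integrable setT (EFin \o J) ->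
  (forall x, integ (fun y => J (x, y))) ->
  integ (fun x => rint (fun y => J (x, y))) /\
  (rint (fun x => rint (fun y => J (x, y))))%:E = (\int[leb \x leb]_z (J z)%:E)%E.
Proof.
(* Integrability of every section makes the real inner integral agree with the extended one at each
   point, not just almost everywhere. *)
move=> iJ sJ; have E : (fun x => (rint (fun y => J (x, y)))%:E) =
    (fun x => \int[leb]_y (EFin \o J) (x, y))%E.
  by apply/funext => x; rewrite EFin_rint.
have iF : integ (fun x => rint (fun y => J (x, y))).
  rewrite /comp E; exact: integrable_fubini_F.
by split=> //; rewrite EFin_rint// E integral12_prod_meas1.
Qed.

Lemma product_integ_section_swap (J : R * R -> R) :
  (leb \x leb)%E.-integrable setT (EFin \o J) ->
  (forall y, integ (fun x => J (x, y))) ->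
  integ (fun y => rint (fun x => J (x, y))) /\
  (rint (fun y => rint (fun x => J (x, y))))%:E = (\int[leb \x leb]_z (J z)%:E)%E.
Proof.
move=> iJ sJ; have E : (fun y => (rint (fun x => J (x, y)))%:E) =
    (fun y => \int[leb]_x (EFin \o J) (x, y))%E.
  by apply/funext => x; rewrite EFin_rint.
(* By Tonelli: the modulus of the partial integral is at most the partial integral of [|J|], whose
   own integral is finite. *)
have iF : integ (fun y => rint (fun x => J (x, y))).
  apply/integrableP; split; first by rewrite /comp E; exact: (@measurable_fubini_G _ _ _ _ R leb leb (EFin \o J) iJ).
  have mJ : measurable_fun setT (EFin \o J) by exact: measurable_int iJ.
  have := (proj1 (@integrable21ltyP _ _ _ _ R leb leb (EFin \o J) mJ)) iJ.
  apply: le_lt_trans.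
  rewrite (_ : (fun x => `|(EFin \o _) x|%E) = (fun y => `|\int[leb]_x (EFin \o J) (x, y)|%E)); last first.
    by apply/funext => y /=; rewrite -EFin_rint//.
  apply: ge0_le_integral => //.
  - by apply: measurableT_comp => //; exact: (@measurable_fubini_G _ _ _ _ R leb leb (EFin \o J) iJ).
  - apply: (@measurable_fun_fubini_tonelli_G _ _ _ _ R leb (fun z => `|(EFin \o J) z|%E)) => //.
    exact: measurableT_comp.
  - by move=> y _; apply: le_abse_integral => //; exact: measurable_int (sJ y).
by split=> //; rewrite EFin_rint// E integral21_prod_meas1.
Qed.

Lemma product_integ_le (J : R * R -> R) (u v : R -> R) :
  measurable_fun setT J -> integ u -> integ v ->
  (forall x y, `|J (x, y)| <= `|u x| * `|v y|) ->
  (leb \x leb)%E.-integrable setT (EFin \o J).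
Proof.
move=> mJ iu iv JB.
have mJ' : measurable_fun setT (EFin \o J) by exact/measurable_EFinP.
apply: (proj2 (@integrable12ltyP _ _ _ _ R leb leb (EFin \o J) mJ')).
have nu := integ_norm iu; have nv := integ_norm iv.
have V0 : 0 <= rint (fun y => `|v y|) by apply: Rintegral_ge0.
apply: (@le_lt_trans _ _ (\int[leb]_x (rint (fun y => `|v y|)%R * `|u x|)%:E)%E); last first.
  rewrite -EFin_rint ?ltry//; exact: integZ.
have m1 x : measurable_fun setT (fun y => J (x, y)).
  by apply: measurableT_comp => //; exact: pair1_measurable.
apply: ge0_le_integral => //.
- by move=> x _; apply: integral_ge0.
- apply: (@measurable_fun_fubini_tonelli_F _ _ _ _ R leb (fun z => `|(EFin \o J) z|%E)) => //.
  exact: measurableT_comp.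
- by apply/measurable_EFinP; exact: integ_measurable (integZ _ nu).
- move=> x _; rewrite mulrC -rintZ// EFin_rint; last exact: integZ.
  apply: ge0_le_integral => //.
  + by apply: measurableT_comp => //; apply/measurable_EFinP; exact: m1.
  + by apply/measurable_EFinP; exact: integ_measurable (integZ _ nv).
  + by move=> y _; rewrite /= lee_fin.
Qed.

(** The kernel [k] will be a cosine or sine of a product of the variables: bounded, but not
    integrable on the plane. Absolute convergence comes from [u] and [v]. *)
Lemma rint_fubini (u v : R -> R) (k : R * R -> R) : integ u -> integ v ->
  measurable_fun setT k -> (forall x y, `|k (x, y)| <= 1) ->
  rint (fun x => u x * rint (fun y => v y * k (x, y))) =
  rint (fun y => v y * rint (fun x => u x * k (x, y))).
Proof.
move=> iu iv mk k1.
have mu := integ_measurable iu; have mv := integ_measurable iv.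
pose J := fun z : R * R => u z.1 * (v z.2 * k z).
have JB x y : `|J (x, y)| <= `|u x| * `|v y|.
  by rewrite /J /= !normrM ler_wpM2l// ler_piMr.
have mJ : measurable_fun setT J.
  apply: measurable_funM; first exact: measurableT_comp.
  by apply: measurable_funM => //; exact: measurableT_comp.
have iJ := product_integ_le mJ iu iv JB.
have s1 x : integ (fun y => v y * k (x, y)).
  apply: (@integ_le _ (fun y => `|v y|)); [|exact: integ_norm|].
    apply: measurable_funM => //; apply: measurableT_comp => //.
  by move=> y; rewrite normrM ler_piMr.
have s2 y : integ (fun x => u x * k (x, y)).
  apply: (@integ_le _ (fun y => `|u y|)); [|exact: integ_norm|].
    apply: measurable_funM => //; apply: measurableT_comp => //.
  by move=> x; rewrite normrM ler_piMr.
have [_ H1] : _ /\ _ := product_integ_section iJ (fun x => integZ (u x) (s1 x)).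
have s2' y : integ (fun x => J (x, y)).
  by apply: eq_integ (integZ (v y) (s2 y)) => x; rewrite /J /= mulrCA.
have [_ H2] := product_integ_section_swap iJ s2'.
move: H1; rewrite -H2 => -[H1].
rewrite (_ : (fun x => u x * _) = (fun x => rint (fun y => J (x, y)))); last first.
  by apply/funext => x; rewrite /J /= rintZ.
rewrite H1; apply: eq_rint => y; rewrite -rintZ//.
by apply: eq_rint => x; rewrite /J /= mulrCA.
Qed.

End Toolkit.

(** * Smooth functions and test functions *)
Section Smooth.
Variable R : realType.
Implicit Types (f g : R -> R).
Local Notation isd x f d := (is_derive (x : R) (1 : R) (f : R -> R) (d : R)).

(** Peeling off the first derivative lets each closure property follow by induction from a formula
    for that derivative alone ([diffn_deriv]). *)
Fixpoint diffn (n : nat) (f : R -> R) : Prop :=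
  if n is n'.+1 then (forall x, derivable f x 1) /\ diffn n' (derive1 f) else True.

Definition smooth f := forall n, diffn n f.

Lemma is_derive_derive1 f (x d : R) : isd x f d ->
  derivable f x 1 /\ (derive1 f) x = d.
Proof. by case=> dv <-; rewrite derive1E. Qed.

Lemma derivable_is_derive1 f (x : R) : derivable f x 1 -> isd x f (derive1 f x).
Proof. by move=> dv; rewrite derive1E; apply: DeriveDef. Qed.

Lemma derivable_continuous f : (forall x, derivable f x 1) -> continuous f.
Proof. by move=> df x; apply/differentiable_continuous/derivable1_diffP/df. Qed.

Lemma smooth_derivable f x : smooth f -> derivable f x 1.
Proof. by move=> /(_ 1%N) /= []. Qed.

Lemma smooth_continuous f : smooth f -> continuous f.
Proof. by move=> sf; apply: derivable_continuous => x; exact: smooth_derivable. Qed.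

Lemma smooth_derive1 f : smooth f -> smooth (derive1 f).
Proof. by move=> sf n; case: (sf n.+1). Qed.

Lemma diffn_le n f : diffn n.+1 f -> diffn n f.
Proof. by elim: n f => //= n IH f [df d2]; split=> //; apply: IH. Qed.

Lemma diffn_deriv n f (f' : R -> R) : (forall x, isd x f (f' x)) ->
  diffn n f' -> diffn n.+1 f.
Proof.
move=> H df' /=; split; first by move=> x; have [] := is_derive_derive1 (H x).
suff -> : (derive1 f) = f' by [].
by apply/funext => x; have [] := is_derive_derive1 (H x).
Qed.

Lemma diffn_cst n (c : R) : diffn n (fun=> c).
Proof.
elim: n c => // n IH c; apply: (@diffn_deriv _ _ (fun=> 0)); exact: IH.
Qed.

Lemma diffnD n f g : diffn n f -> diffn n g -> diffn n (fun x => f x + g x).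
Proof.
elim: n f g => // n IH f g /= [df df'] [dg dg'].
apply: (@diffn_deriv _ _ (fun x => (derive1 f) x + (derive1 g) x)); last exact: IH.
by move=> x; apply: is_deriveD; apply: derivable_is_derive1.
Qed.

Lemma diffnM n f g : diffn n f -> diffn n g -> diffn n (fun x => f x * g x).
Proof.
elim: n f g => // n IH f g Hf Hg; have [df df'] := Hf; have [dg dg'] := Hg.
apply: (@diffn_deriv _ _ (fun x => f x * (derive1 g) x + g x * (derive1 f) x)).
  by move=> x; apply: is_deriveM; apply: derivable_is_derive1.
by apply: diffnD; apply: IH => //; exact: diffn_le.
Qed.

Lemma is_derive_affine (t b x : R) : isd x (fun x : R => t * x + b) t.
Proof.
apply: (@is_derive_eq _ _ _ (cst t * id + cst b) x 1 t (t *: 1 + x *: 0 + 0)).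
by rewrite scaler0 !addr0 /GRing.scale /= mulr1.
Qed.

Lemma diffn_affine n (t b : R) f : diffn n f -> diffn n (fun x => f (t * x + b)).
Proof.
elim: n f => // n IH f [df df'].
apply: (@diffn_deriv _ _ (fun x => (derive1 f) (t * x + b) * t)).
  move=> x; apply: (@is_derive1_comp _ f (fun x => t * x + b)).
    exact: derivable_is_derive1.
  exact: is_derive_affine.
by apply: diffnM; [exact: IH|exact: diffn_cst].
Qed.

Lemma smooth_cst (c : R) : smooth (fun=> c). Proof. by move=> n; exact: diffn_cst. Qed.

Lemma smoothD f g : smooth f -> smooth g -> smooth (fun x => f x + g x).
Proof. by move=> sf sg n; exact: diffnD. Qed.

Lemma smoothM f g : smooth f -> smooth g -> smooth (fun x => f x * g x).
Proof. by move=> sf sg n; exact: diffnM. Qed.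

Lemma smooth_affine (t b : R) f : smooth f -> smooth (fun x => f (t * x + b)).
Proof. by move=> sf n; exact: diffn_affine. Qed.

Lemma smooth_id : smooth (fun x => x).
Proof.
case=> // n; apply: (@diffn_deriv _ _ (fun=> 1)); last exact: diffn_cst.
Qed.

Lemma smooth_cos_sin : smooth (@cos R) /\ smooth (@sin R).
Proof.
suff H n : diffn n (@cos R) /\ diffn n (@sin R).
  by split=> n; have [] := H n.
elim: n => // n [IH1 IH2]; split.
- apply: (@diffn_deriv _ _ (fun x => - 1 * sin x)).
    by move=> x; rewrite mulN1r; exact: is_derive_cos.
  by apply: diffnM => //; exact: diffn_cst.
- by apply: (@diffn_deriv _ _ (@cos R)) => // x; exact: is_derive_sin.
Qed.

Lemma smooth_cosl (t : R) : smooth (fun x => cos (t * x)).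
Proof.
have := smooth_affine t 0 smooth_cos_sin.1.
by under [X in smooth X]eq_fun do rewrite addr0.
Qed.

Lemma smooth_sinl (t : R) : smooth (fun x => sin (t * x)).
Proof.
have := smooth_affine t 0 smooth_cos_sin.2.
by under [X in smooth X]eq_fun do rewrite addr0.
Qed.

(* The factor [x^(-k)] makes the family stable under differentiation. *)
Definition flat (k : nat) (x : R) : R :=
  if 0 < x then x^-1 ^+ k * expR (- x^-1) else 0.

Lemma flat_ge0 k x : 0 <= flat k x.
Proof.
rewrite /flat; case: ifPn => // x0.
by rewrite mulr_ge0 ?expR_ge0// exprn_ge0// invr_ge0 ltW.
Qed.

(** With [u = x^-1], the term [u^(k+2) / (k+2)!] of the exponential series is at most [e^u]. Two
    powers more than [k] leave the factor [x^2], which makes the derivative at 0 vanish. *)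
Lemma flat_le k x : flat k x <= (k.+2)`!%:R * x ^+ 2.
Proof.
rewrite /flat; case: ifPn => x0; last by rewrite mulr_ge0// sqr_ge0.
have u0 : 0 < x^-1 by rewrite invr_gt0.
have H : x^-1 ^+ k.+2 / (k.+2)`!%:R <= expR x^-1.
  by apply: le_trans (expR_ge1Dxn k.+1 (ltW u0)); rewrite lerDr.
have f0 : 0 < (k.+2)`!%:R :> R by rewrite ltr0n fact_gt0.
rewrite expRN ler_pdivrMr ?expR_gt0//.
move: H; rewrite ler_pdivrMr// => H.
have xn0 : x != 0 by rewrite gt_eqF.
have -> : x^-1 ^+ k = x ^+ 2 * x^-1 ^+ k.+2.
  by rewrite 2!(exprS x^-1) (expr2 x); move: (x^-1 ^+ k) => e; field.
by rewrite [leRHS]mulrAC mulrC ler_wpM2r ?sqr_ge0// mulrC.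
Qed.

Lemma flat_derive k x : isd x (flat k) (flat k.+2 x - k%:R * flat k.+1 x).
Proof.
have [x0|x0|<-] := ltgtP 0 x.
- have E : {near x, flat k =1 (fun x => x^-1 ^+ k * expR (- x^-1))}.
    by near=> y; rewrite /flat ifT//; near: y; exact: lt_nbhsr.
  have xn0 : x != 0 by rewrite gt_eqF.
  have D : isd x (fun x : R => x^-1 ^+ k * expR (- x^-1))
     (flat k.+2 x - k%:R * flat k.+1 x).
    have dV : isd x (fun y : R => y^-1) (- x ^- 2).
      by apply: is_derive_eq; [exact: is_deriveV|rewrite /GRing.scale /= mulr1].
    have dE : isd x (fun y : R => expR (- y^-1)) (expR (- x^-1) * x ^- 2).
      apply: (@is_derive1_comp _ expR (fun y => - y^-1)).
      by have := is_deriveN dV; rewrite opprK.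
    have dX := is_deriveX k dV.
    have EX : ((fun y : R => y^-1) ^+ k : R -> R) = (fun y : R => y^-1 ^+ k).
      by apply/funext => y; rewrite exprfctE.
    rewrite EX in dX.
    apply: (is_derive_eq (is_deriveM dX dE)).
    rewrite /flat x0 /GRing.scale /= !exprS.
    case: k {E dX EX} => [|k]; rewrite /= ?exprS; field; rewrite xn0//.
  by apply: near_eq_is_derive D; near=> y; apply/esym; near: y; exact: E.
- have E : {near x, (fun=> 0) =1 flat k}.
    near=> y; rewrite /flat ifF//; apply/negbTE; rewrite -leNgt ltW//.
    by near: y; exact: lt_nbhsl.
  have -> : flat k.+2 x - k%:R * flat k.+1 x = 0.
    by rewrite /flat !(ltNge 0 x) (ltW x0) /= mulr0 subrr.
  by apply: near_eq_is_derive E _; exact: is_derive_cst.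
- have -> : flat k.+2 0 - k%:R * flat k.+1 0 = 0.
    by rewrite /flat !ltxx mulr0 subrr.
  have f0 : flat k 0 = 0 by rewrite /flat ltxx.
  (* The difference quotient at 0. Its value at [z = 0] is 0 by the convention for division by zero,
     and [flat_le] bounds it by a multiple of [|z|], hence continuity there. *)
  apply/is_derive1_caratheodory; exists (fun z => flat k z / z); split.
  + move=> z; rewrite f0 !subr0.
    by have [->|z0] := eqVneq z 0; rewrite ?f0 ?mul0r// divfK.
  + rewrite /prop_for /continuous_at /= f0 mul0r; apply/cvgrPdist_le => /= e e0.
    have Cp : 0 < (k.+2)`!%:R :> R by rewrite ltr0n fact_gt0.
    near=> z; rewrite sub0r normrN; have [->|z0] := eqVneq z 0; first by rewrite f0 mul0r normr0 ltW.
    rewrite normrM normfV ler_pdivrMr ?normr_gt0// ger0_norm ?flat_ge0//.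
    apply: le_trans (flat_le _ _) _; rewrite -real_normK ?num_real// expr2 mulrA ler_wpM2r//.
    rewrite mulrC -ler_pdivlMr//; near: z.
    exists (e / (k.+2)`!%:R) => /=; first exact: divr_gt0.
    by move=> z /=; rewrite sub0r normrN => /ltW.
  + by rewrite f0 mul0r.
Unshelve. all: by end_near. Qed.

Lemma smooth_flat k : smooth (flat k).
Proof.
move=> n; elim: n k => // n IH k; apply: diffn_deriv (flat_derive k) _.
have -> : (fun x => flat k.+2 x - k%:R * flat k.+1 x) =
  (fun x => flat k.+2 x + (- k%:R) * flat k.+1 x).
  by apply/funext => x; rewrite mulNr.
by apply: diffnD => //; apply: diffnM => //; exact: diffn_cst.
Qed.

(** * Smooth functions of compact support *)

Definition test f := smooth f /\ exists L : R, forall x, L < `|x| -> f x = 0.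

Lemma test_derive1 f : test f -> test (derive1 f).
Proof.
move=> [sf [L fL]]; split; first exact: smooth_derive1.
exists L => x Lx; have E : {near x, (fun=> 0) =1 f}.
  near=> y; apply/esym/fL; near: y.
  have : `|y| @[y --> x] --> `|x| by apply: cvg_norm; exact: cvg_id.
  by move/cvgr_gt; apply.
have D : isd x f 0 by apply: near_eq_is_derive E _; exact: is_derive_cst.
by have [] := is_derive_derive1 D.
Unshelve. all: by end_near. Qed.

Lemma testM f g : test f -> smooth g -> test (fun x => f x * g x).
Proof.
move=> [sf [L fL]] sg; split; first exact: smoothM.
by exists L => x /fL ->; rewrite mul0r.
Qed.

Lemma testD f g : test f -> test g -> test (fun x => f x + g x).
Proof.
move=> [sf [L fL]] [sg [K gK]]; split; first exact: smoothD.
by exists (Num.max L K) => x; rewrite gt_max => /andP[/fL -> /gK ->]; rewrite addr0.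
Qed.

Lemma testZ (c : R) f : test f -> test (fun x => c * f x).
Proof.
move=> tf; have := testM tf (smooth_cst c).
by under [X in test X]eq_fun do rewrite mulrC.
Qed.

Lemma test_affine (t b : R) f : t != 0 -> test f -> test (fun x => f (t * x + b)).
Proof.
move=> t0 [sf [L fL]]; split; first exact: smooth_affine.
exists ((L + `|b|) / `|t|) => x; rewrite ltr_pdivrMr ?normr_gt0// => Hx; apply: fL.
have : `|t * x| <= `|t * x + b| + `|b|.
  by rewrite -{1}(addrK b (t * x)); apply: ler_normB.
by rewrite normrM mulrC => H; rewrite -(ltrD2r `|b|); apply: lt_le_trans Hx H.
Qed.

Definition bump (x : R) : R := flat 0 (1 - x) * flat 0 (1 + x).

Lemma bump_ge0 x : 0 <= bump x.
Proof. by rewrite mulr_ge0 ?flat_ge0. Qed.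

Lemma bump_eq0 x : 1 <= `|x| -> bump x = 0.
Proof.
rewrite /bump /flat ler_normr => /orP[H|H].
  by rewrite subr_gt0 ltNge H /= mul0r.
by rewrite mulrC ifF ?mul0r// ltNge -lerBrDl sub0r lerNr H.
Qed.

Lemma test_bump : test bump.
Proof.
split; last by exists 1 => x /ltW; exact: bump_eq0.
apply: smoothM.
  have := smooth_affine (-1) 1 (smooth_flat 0).
  by under [X in smooth X]eq_fun do rewrite mulN1r addrC.
have := smooth_affine 1 1 (smooth_flat 0).
by under [X in smooth X]eq_fun do rewrite mul1r addrC.
Qed.

Lemma bump0_gt0 : 0 < bump 0.
Proof.
by rewrite /bump /flat subr0 addr0 ltr01 mulr_gt0// expr0 mul1r expR_gt0.
Qed.

Local Notation leb := (@lebesgue_measure R).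
Local Notation rint f := (Rintegral leb setT f).
Local Notation integ f := (leb.-integrable setT (EFin \o f)).

Lemma continuous_support_integ f (L : R) : continuous f ->
  (forall x, L < `|x| -> f x = 0) -> integ f.
Proof.
move=> cf fL.
have i1 : leb.-integrable `[-L, L] (EFin \o f).
  apply: continuous_compact_integrable; first exact: segment_compact.
  exact: continuous_subspaceT.
have mL : measurable (`[(-L)%R, L]%classic : set (measurableTypeR R)) by exact: measurable_itv.
have := (@integrable_mkcond _ _ _ leb _ (EFin \o f) mL).1 i1.
apply: eq_integrable => // x _; rewrite patchE; case: ifPn => //.
rewrite notin_setE /= in_itv /= => /negP xL; rewrite /= fL// ltNge.
by apply: contra xL; rewrite ler_norml.
Qed.

Lemma test_integ f : test f -> integ f.
Proof. by move=> [sf [L fL]]; apply: (continuous_support_integ _ fL); exact: smooth_continuous. Qed.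

Lemma test_bounded f : test f -> exists2 K : R, 0 <= K & forall x, `|f x| <= K.
Proof.
move=> [sf [L fL]].
have [L0|L0] := ltP L 0.
  by exists 0 => // x; rewrite fL ?normr0// (lt_le_trans L0).
have cf := smooth_continuous sf.
have [||c _ Hc] := @EVT_max R (fun x => `|f x|) (-L) L; first by lra.
  by apply: continuous_subspaceT => x; apply: continuous_comp; [exact: cf|exact: norm_continuous].
exists `|f c| => // x.
have [/fL ->|xL] := ltP L `|x|; first by rewrite normr0.
by apply: Hc; rewrite in_itv /= -ler_norml.
Qed.

Lemma rint_derive1_test f : test f -> rint (derive1 f) = 0.
Proof.
move=> tf; have [sf [L fL]] := tf; have [_ [K f'K]] := test_derive1 tf.
(* Both [f] and its derivative vanish from [M] on, so the fundamental theorem of calculus on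
   [[-M, M]] computes the whole integral. *)
pose M := Num.max `|L| `|K| + 1.
have M0 : 0 < M by rewrite ltr_wpDl// le_max normr_ge0.
have LM : L < M by rewrite (le_lt_trans (ler_norm L))// ltr_pwDr// le_max lexx.
have KM : K < M by rewrite (le_lt_trans (ler_norm K))// ltr_pwDr// le_max lexx orbT.
have cf := smooth_continuous sf.
have cf' : continuous (derive1 f) by exact/smooth_continuous/smooth_derive1.
have NM : - M < M by rewrite -subr_gt0 opprK addr_gt0.
have H : (\int[leb]_(x in `[(-M)%R, M]) (derive1 f x)%:E = (f M)%:E - (f (- M))%:E)%E.
  apply: continuous_FTC2 => //; first exact: continuous_subspaceT.
  split; [by move=> x _; exact: smooth_derivable|..].
  - exact: cvg_at_right_filter (cf _).
  - exact: cvg_at_left_filter (cf _).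
rewrite /Rintegral.
have -> : (\int[leb]_x (derive1 f x)%:E = \int[leb]_(x in `[(-M)%R, M]) (derive1 f x)%:E)%E.
  rewrite [RHS]integral_mkcond; apply: eq_integral => x _.
  rewrite patchE; case: ifPn => //.
  rewrite notin_setE /= in_itv /= => /negP xL; rewrite /= f'K// (lt_trans KM)// ltNge.
  by apply: contra xL; rewrite ler_norml.
have LM' : L < `|M| by rewrite (lt_le_trans LM)// ler_norm.
by rewrite H (fL M)// (fL (- M)) ?normrN// subee.
Qed.

End Smooth.

(** * Cosine and sine transforms of test functions *)
Section Transforms.
Variable R : realType.
Local Notation leb := (@lebesgue_measure R).
Local Notation rint f := (Rintegral leb setT f).
Local Notation integ f := (leb.-integrable setT (EFin \o f)).
Local Notation isd x f d := (is_derive (x : R) (1 : R) (f : R -> R) (d : R)).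
Implicit Types (a b f g : R -> R).

Definition fc a (x : R) : R := rint (fun y => a y * cos (2 * pi * x * y)).
Definition fs a (x : R) : R := rint (fun y => a y * sin (2 * pi * x * y)).

Lemma measurable_cosl (t : R) : measurable_fun setT (fun y : R => cos (t * y)).
Proof. by apply: continuous_measurable_fun; apply: smooth_continuous; exact: smooth_cosl. Qed.

Lemma measurable_sinl (t : R) : measurable_fun setT (fun y : R => sin (t * y)).
Proof. by apply: continuous_measurable_fun; apply: smooth_continuous; exact: smooth_sinl. Qed.

Lemma integ_cosl a (t : R) : integ a -> integ (fun y => a y * cos (t * y)).
Proof.
move=> ia; apply: (@integ_le _ _ (fun y => `|a y|)); last 1 first.
- by move=> y; rewrite normrM ler_piMr// cos_max.
- apply: measurable_funM; [exact: integ_measurable ia|exact: measurable_cosl].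
- exact: integ_norm.
Qed.

Lemma integ_sinl a (t : R) : integ a -> integ (fun y => a y * sin (t * y)).
Proof.
move=> ia; apply: (@integ_le _ _ (fun y => `|a y|)); last 1 first.
- by move=> y; rewrite normrM ler_piMr// sin_max.
- apply: measurable_funM; [exact: integ_measurable ia|exact: measurable_sinl].
- exact: integ_norm.
Qed.

Lemma fc_bounded a x : integ a -> `|fc a x| <= rint (fun y => `|a y|).
Proof.
move=> ia; apply: le_trans (le_norm_rint (integ_cosl _ ia)) _.
apply: le_rint; [exact: integ_norm (integ_cosl _ ia)|exact: integ_norm|].
by move=> y; rewrite normrM ler_piMr// cos_max.
Qed.

Lemma fs_bounded a x : integ a -> `|fs a x| <= rint (fun y => `|a y|).
Proof.
move=> ia; apply: le_trans (le_norm_rint (integ_sinl _ ia)) _.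
apply: le_rint; [exact: integ_norm (integ_sinl _ ia)|exact: integ_norm|].
by move=> y; rewrite normrM ler_piMr// sin_max.
Qed.

Lemma testX (c : R) a : test a -> test (fun y => c * y * a y).
Proof.
move=> ta; have := testM ta (smoothM (smooth_cst c) (@smooth_id R)).
by under [X in test X]eq_fun do rewrite mulrC.
Qed.

(** Differentiation under the integral sign: the derivative in [x] is dominated by [|2 pi y a(y)|],
    integrable because [a] has compact support. The abstract pair [k, k'] covers cosine and sine at
    once. *)
Lemma transform_derive a (k k' : R -> R) (x : R) :
  test a -> (forall u, isd u k (k' u)) ->
  (forall u, `|k u| <= 1) -> (forall u, `|k' u| <= 1) -> continuous k' ->
  isd x (fun x => rint (fun y => a y * k (2 * pi * x * y)))
        (rint (fun y => (2 * pi * y * a y) * k' (2 * pi * x * y))).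
Proof.
move=> ta dk k1 k'1 ck'.
have ck : continuous k.
  by apply: derivable_continuous => u; have [] := is_derive_derive1 (dk u).
pose f (x y : R) : R := a y * k (2 * pi * x * y).
have df z y : isd z (f^~ y) ((2 * pi * y * a y) * k' (2 * pi * z * y)).
  have H : isd z (fun z : R => k (2 * pi * z * y)) (k' (2 * pi * z * y) * (2 * pi * y)).
    apply: (@is_derive1_comp _ k (fun z : R => 2 * pi * z * y)) => //.
    have := is_derive_affine (2 * pi * y) 0 z.
    suff -> : (fun x : R => 2 * pi * y * x + 0) = (fun z : R => 2 * pi * z * y) by [].
    by apply/funext => w; rewrite addr0 mulrAC.
  have D := is_deriveM (is_derive_cst (a y) z 1) H.
  apply: (is_derive_eq D).
  by rewrite scaler0 addr0 /GRing.scale /=; ring.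
have Ia : [set` `](x - 1), (x + 1)[] x by rewrite /= in_itv /= ltrBlDr ltrDl ltr01.
have intf (z : R) : [set` `](x - 1), (x + 1)[] z -> leb.-integrable setT (EFin \o f z).
  move=> _; apply: (@integ_le _ _ (fun y => `|a y|)).
  - apply: measurable_funM; first exact: integ_measurable (test_integ ta).
    apply: measurableT_comp; first exact: continuous_measurable_fun.
    exact: measurable_funM.
  - exact: integ_norm (test_integ ta).
  - by move=> y; rewrite normrM ler_piMr.
have tG := testX (2 * pi) ta.
have iG := integ_norm (test_integ tG).
have derf (z y : R) : [set` `](x - 1), (x + 1)[] z -> [set: R] y -> derivable (f ^~ y) z 1.
  by move=> _ _; have [] := is_derive_derive1 (df z y).
have pf (z y : R) : partial1of2 f z y = (2 * pi * y * a y) * k' (2 * pi * z * y).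
  by rewrite /partial1of2; have [_] := is_derive_derive1 (df z y).
have Gub (z y : R) : [set` `](x - 1), (x + 1)[] z -> [set: R] y ->
    `|partial1of2 f z y| <= `|2 * pi * y * a y|.
  by move=> _ _; rewrite pf normrM ler_piMr.
have H1 := @derivable_under_integral R _ _ leb f setT measurableT x (x - 1) (x + 1)
  Ia intf derf (fun y => `|2 * pi * y * a y|) (fun y => normr_ge0 _) iG Gub.
have H2 := @differentiation_under_integral R _ _ leb f setT measurableT x (x - 1) (x + 1)
  Ia intf derf (fun y => `|2 * pi * y * a y|) (fun y => normr_ge0 _) iG Gub.
have := derivable_is_derive1 H1; rewrite H2.
by under [X in Rintegral _ _ X]eq_fun do rewrite pf.
Qed.

Lemma fc_derive a x : test a ->
  isd x (fc a) (fs (fun y => - (2 * pi) * y * a y) x).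
Proof.
move=> ta; have H := @transform_derive a (@cos R) (fun u => - sin u) x ta
  (@is_derive_cos R) (@cos_max R) _ _.
apply: is_derive_eq; first apply: H.
- by move=> u; rewrite normrN sin_max.
- by move=> u; apply: continuousN; exact: continuous_sin.
- by apply: eq_rint => y; rewrite mulrN !mulNr.
Qed.

Lemma fs_derive a x : test a ->
  isd x (fs a) (fc (fun y => 2 * pi * y * a y) x).
Proof.
move=> ta; exact: (@transform_derive a (@sin R) (@cos R) x ta
  (@is_derive_sin R) (@sin_max R) (@cos_max R) (@continuous_cos R)).
Qed.

(* The derivative of [a(y) k(2 pi x y)] has integral 0. *)
Lemma transform_parts a (k k' : R -> R) (x : R) : test a -> smooth (fun y => k (2 * pi * x * y)) ->
  (forall u, isd u k (k' u)) ->
  integ (fun y => derive1 a y * k (2 * pi * x * y)) ->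
  integ (fun y => a y * k' (2 * pi * x * y)) ->
  2 * pi * x * rint (fun y => a y * k' (2 * pi * x * y)) =
  - rint (fun y => derive1 a y * k (2 * pi * x * y)).
Proof.
move=> ta sk dk i1 i2.
have H := rint_derive1_test (testM ta sk).
have E : derive1 (fun y => a y * k (2 * pi * x * y)) =
   (fun y => 2 * pi * x * (a y * k' (2 * pi * x * y)) + derive1 a y * k (2 * pi * x * y)).
  apply/funext => y.
  have D1 : isd y (fun y => k (2 * pi * x * y)) (k' (2 * pi * x * y) * (2 * pi * x)).
    apply: (@is_derive1_comp _ k (fun y : R => 2 * pi * x * y)) => //.
    have := is_derive_affine (2 * pi * x) 0 y.
    by under [X in is_derive _ _ X _]eq_fun do rewrite addr0.
  have D2 : isd y a (derive1 a y) by apply: derivable_is_derive1; apply: smooth_derivable; case: ta.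
  have [_ ->] := is_derive_derive1 (is_deriveM D2 D1).
  by rewrite /GRing.scale /=; ring.
move: H; rewrite E rintD//; last exact: integZ.
by rewrite rintZ// => /eqP; rewrite addr_eq0 => /eqP.
Qed.

(** Integration by parts trades a factor [x] for a derivative of the density. This and [fs_mulX]
    give the rapid decay of [itest] functions. *)
Lemma fc_mulX a x : test a -> x * fc a x = fs (fun y => - (2 * pi)^-1 * derive1 a y) x.
Proof.
move=> ta; have ta' := test_derive1 ta.
have H := @transform_parts a (@sin R) (@cos R) x ta (smooth_sinl _) (@is_derive_sin R)
  (integ_sinl _ (test_integ ta')) (integ_cosl _ (test_integ ta)).
have p0 : 2 * pi != 0 :> R by rewrite mulf_neq0// gt_eqF// pi_gt0.
have -> : x * fc a x = (2 * pi)^-1 * (2 * pi * x * fc a x).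
  by rewrite -mulrA mulKf.
rewrite [X in _ * X]H mulrN -mulNr -rintZ; last exact: integ_sinl (test_integ ta').
by apply: eq_rint => y; rewrite mulrA.
Qed.

Lemma fs_mulX a x : test a -> x * fs a x = fc (fun y => (2 * pi)^-1 * derive1 a y) x.
Proof.
move=> ta; have ta' := test_derive1 ta.
have iN : integ (fun y => a y * - sin (2 * pi * x * y)).
  by apply: eq_integ (integZ (-1) (integ_sinl (2 * pi * x) (test_integ ta))) => y /=;
    rewrite mulN1r mulrN.
have H := @transform_parts a (@cos R) (fun u => - sin u) x ta (smooth_cosl _) (@is_derive_cos R)
  (integ_cosl _ (test_integ ta')) iN.
have E : rint (fun y => a y * - sin (2 * pi * x * y)) = - fs a x.
  rewrite -[RHS]mulN1r -rintZ; last exact: integ_sinl (test_integ ta).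
  by apply: eq_rint => y; rewrite mulN1r mulrN.
have p0 : 2 * pi != 0 :> R by rewrite mulf_neq0// gt_eqF// pi_gt0.
have -> : x * fs a x = (2 * pi)^-1 * (- (2 * pi * x * - fs a x)).
  by rewrite !mulrN opprK -(mulrA (2 * pi)) mulKf.
rewrite -[X in - (_ * X)]E H opprK -rintZ; last exact: integ_cosl (test_integ ta').
by apply: eq_rint => y; rewrite mulrA.
Qed.

(* Inverse Fourier transforms of test functions: this class is stable under
   differentiation and multiplication by [x], and its members are bounded. *)
Definition itest f := exists a b, [/\ test a, test b & forall x, f x = fc a x + fs b x].

Lemma itest_derive f : itest f ->
  (forall x, derivable f x 1) /\ itest (derive1 f).
Proof.
move=> [a [b [ta tb fE]]].
have -> : f = (fun x => fc a x + fs b x) by apply/funext.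
pose b' y := - (2 * pi) * y * a y; pose a' y := 2 * pi * y * b y.
have D x : isd x (fun x => fc a x + fs b x) (fs b' x + fc a' x).
  by apply: is_deriveD; [exact: fc_derive|exact: fs_derive].
split; first by move=> x; have [] := is_derive_derive1 (D x).
exists a', b'; split; [exact: testX|exact: testX|].
by move=> x; have [_ ->] := is_derive_derive1 (D x); rewrite addrC.
Qed.

Lemma fcD a b x : integ a -> integ b -> fc (fun y => a y + b y) x = fc a x + fc b x.
Proof.
move=> ia ib; rewrite /fc -rintD; [|exact: integ_cosl|exact: integ_cosl].
by apply: eq_rint => y; rewrite mulrDl.
Qed.

Lemma fsD a b x : integ a -> integ b -> fs (fun y => a y + b y) x = fs a x + fs b x.
Proof.
move=> ia ib; rewrite /fs -rintD; [|exact: integ_sinl|exact: integ_sinl].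
by apply: eq_rint => y; rewrite mulrDl.
Qed.

Lemma itest_mulX f : itest f -> itest (fun x => x * f x).
Proof.
move=> [a [b [ta tb fE]]].
exists (fun y => (2 * pi)^-1 * derive1 b y), (fun y => - (2 * pi)^-1 * derive1 a y).
split; [exact/testZ/test_derive1|exact/testZ/test_derive1|].
by move=> x; rewrite fE mulrDr fc_mulX// fs_mulX// addrC.
Qed.

Lemma itest_mulXn n f : itest f -> itest (fun x => x ^+ n * f x).
Proof.
move=> tf; elim: n => [|n IH].
  by under [X in itest X]eq_fun do rewrite expr0 mul1r.
by under [X in itest X]eq_fun do rewrite exprS -mulrA; exact: itest_mulX.
Qed.

Lemma itest_bounded f : itest f -> exists K : R, forall x, `|f x| <= K.
Proof.
move=> [a [b [ta tb fE]]].
exists (rint (fun y => `|a y|) + rint (fun y => `|b y|)) => x.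
rewrite fE (le_trans (ler_normD _ _))// lerD//.
  exact/fc_bounded/test_integ.
exact/fs_bounded/test_integ.
Qed.

Lemma itest_decay n f : itest f -> exists K : R, forall x, `|x| ^+ n * `|f x| <= K.
Proof.
move=> /(itest_mulXn n) /itest_bounded [K HK]; exists K => x.
by rewrite -normrX -normrM.
Qed.

Lemma itest_iter n f : itest f -> itest (iter n (fun h : R -> R => derive1 h) f).
Proof. by move=> tf; elim: n => //= n /itest_derive []. Qed.

Lemma itest_continuous f : itest f -> continuous f.
Proof. by move=> /itest_derive [df _]; exact: derivable_continuous. Qed.

Lemma schwartz_itest (f : R -> R[i]) :
  itest (fun t => complex.Re (f t)) -> itest (fun t => complex.Im (f t)) -> schwartz f.
Proof.
move=> tr ti b; have tr' := itest_iter b tr; have ti' := itest_iter b ti.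
split; first by move=> x; split; [exact: (itest_derive tr').1|exact: (itest_derive ti').1].
move=> a; have [K HK] := itest_decay a tr'; have [K' HK'] := itest_decay a ti'.
by exists (Num.max K K') => x; rewrite !le_max HK HK' orbT.
Qed.

Lemma oneDsqrV_integral : (\int[leb]_x ((oneDsqr x)^-1)%:E = pi%:E)%E.
Proof.
rewrite ge0_symfun_integralT.
- have -> : [set x : R | (0 <= x)%R] = [set` `[0%R, +oo[].
    by apply/seteqP; split => x /=; rewrite in_itv /= andbT.
  by rewrite integral0y_oneDsqr -EFinM; congr EFin; field.
- by move=> x; rewrite invr_ge0 (le_trans ler01)// oneDsqr_ge1.
- exact: continuous_oneDsqrV.
- by move=> x; rewrite /= /oneDsqr sqrrN.
Qed.

Lemma oneDsqr_gt0 (x : R) : 0 < oneDsqr x.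
Proof. by rewrite (lt_le_trans ltr01)// oneDsqr_ge1. Qed.

Lemma oneDsqrV_integ : integ (fun x => (oneDsqr x)^-1).
Proof.
apply/integrableP; split.
  by apply/measurable_EFinP; apply: continuous_measurable_fun; exact: continuous_oneDsqrV.
under eq_integral do rewrite /= ger0_norm ?invr_ge0 ?(ltW (oneDsqr_gt0 _))//.
by rewrite oneDsqrV_integral ltry.
Qed.

(** Sum of the decay estimates of orders 0 and 2. The majorant has a known integral and scales well,
    so it also yields the [L^p] norms of packets. *)
Lemma itest_le f : itest f -> exists2 K : R, 0 <= K & forall x, `|f x| <= K * (oneDsqr x)^-1.
Proof.
move=> tf; have [K HK] := itest_decay 0 tf; have [K' HK'] := itest_decay 2 tf.
have K0 : 0 <= K by apply: le_trans (HK 0); rewrite expr0 mul1r.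
have K'0 : 0 <= K' by apply: le_trans (HK' 0); rewrite mulr_ge0.
exists (K + K'); first exact: addr_ge0.
move=> x; rewrite ler_pdivlMr ?oneDsqr_gt0// /oneDsqr mulrDr mulr1 lerD//.
  by have := HK x; rewrite expr0 mul1r.
by have := HK' x; rewrite real_normK ?num_real// mulrC.
Qed.

Lemma itest_integ f : itest f -> integ f.
Proof.
move=> tf; have [K _ HK] := itest_le tf.
apply: integ_le (integZ K oneDsqrV_integ) HK.
exact: continuous_measurable_fun (itest_continuous tf).
Qed.

End Transforms.

(** * Fourier inversion *)
Section Inversion.
Variable R : realType.
Local Notation leb := (@lebesgue_measure R).
Local Notation rint f := (Rintegral leb setT f).
Local Notation integ f := (leb.-integrable setT (EFin \o f)).
Local Notation isd x f d := (is_derive (x : R) (1 : R) (f : R -> R) (d : R)).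
Implicit Types (a b f g : R -> R).

(* Summability kernel for Fourier inversion: its Fourier transform
   [2 / (1 + (2 pi s)^2)] is integrable of mass 1. *)
Definition laplace (x : R) : R := expR (- `|x|).

Lemma laplace_continuous : continuous laplace.
Proof.
move=> x; apply: continuous_comp; last exact: continuous_expR.
by apply: continuousN; exact: norm_continuous.
Qed.

Lemma laplace_ge0 x : 0 <= laplace x. Proof. exact: expR_ge0. Qed.

Lemma laplace_le1 x : laplace x <= 1.
Proof. by rewrite /laplace expR_le1 oppr_le0. Qed.

(** Adding 1 to the cosine makes the integrand nonnegative, as the fundamental theorem on a
    half-line requires; [laplace_cos] subtracts the extra mass again. *)
Lemma laplace1Dcos_integral (b : R) :
  (\int[leb]_x (laplace x * (1 + cos (b * x)))%:E = (2 * (1 + (oneDsqr b)^-1))%:E)%E.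
Proof.
rewrite ge0_symfun_integralT.
- have -> : [set x : R | (0 <= x)%R] = [set` `[0%R, +oo[].
    by apply/seteqP; split => x /=; rewrite in_itv /= andbT.
  (* The antiderivative of [e^(-x) (1 + cos (b x))] that tends to 0 at infinity, so the half-line
     integral is [- F 0]. *)
  pose F (x : R) := - expR (- x) + expR (- x) * ((oneDsqr b)^-1 * (b * sin (b * x) - cos (b * x))).
  have dE (x : R) : isd x (fun x => expR (- x)) (- expR (- x)).
    have D : isd x (fun x => - x) (-1) by apply: is_deriveN.
    have := @is_derive1_comp _ expR (fun x => - x) x _ _ (is_derive_expR _) D.
    by rewrite mulrN1.
  have dC (x : R) : isd x (fun x => cos (b * x)) (- sin (b * x) * b).
    apply: (@is_derive1_comp _ cos (fun x : R => b * x)).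
    by have := is_derive_affine b 0 x; under [X in is_derive _ _ X _]eq_fun do rewrite addr0.
  have dS (x : R) : isd x (fun x => sin (b * x)) (cos (b * x) * b).
    apply: (@is_derive1_comp _ sin (fun x : R => b * x)).
    by have := is_derive_affine b 0 x; under [X in is_derive _ _ X _]eq_fun do rewrite addr0.
  have b0 : oneDsqr b != 0 by rewrite gt_eqF// oneDsqr_gt0.
  have dF (x : R) : isd x F (expR (- x) * (1 + cos (b * x))).
    have D1 := is_deriveN (dE x).
    have D2 := is_deriveM (is_derive_cst ((oneDsqr b)^-1) x 1)
       (is_deriveB (is_deriveM (is_derive_cst b x 1) (dS x)) (dC x)).
    have D3 := is_deriveD D1 (is_deriveM (dE x) D2).
    apply: (is_derive_eq D3).
    transitivity (- - expR (- x) + (expR (- x) * ((oneDsqr b)^-1 * (b * (cos (b * x) * b)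
       + sin (b * x) * 0 - - sin (b * x) * b) + (b * sin (b * x) - cos (b * x)) * 0)
       + (oneDsqr b)^-1 * (b * sin (b * x) - cos (b * x)) * - expR (- x))) => //.
    move: b0; rewrite /oneDsqr => b0; field.
    exact: b0.
  have F0 : F 0 = - (1 + (oneDsqr b)^-1).
    by rewrite /F !oppr0 expR0 !mulr0 sin0 cos0 mulr0; ring.
  have -> : (\int[leb]_(x in [set` `[0%R, +oo[]) (laplace x * (1 + cos (b * x)))%:E =
     \int[leb]_(x in [set` `[0%R, +oo[]) (expR (- x) * (1 + cos (b * x)))%:E)%E.
    apply: eq_integral => x; rewrite inE /= in_itv /= andbT => x0.
    by rewrite /laplace ger0_norm.
  rewrite (@ge0_continuous_FTC2y _ _ F 0 0).
  + by rewrite F0 sub0e -EFinN opprK -EFinM.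
  + by move=> x _; rewrite mulr_ge0 ?expR_ge0// -lerBlDl sub0r cos_geN1.
  + have cE : continuous (fun x : R => expR (- x) * (1 + cos (b * x))).
      move=> x; apply: cvgM.
        exact: (derivable_continuous (fun x => (is_derive_derive1 (dE x)).1)).
      apply: cvgD; first exact: cvg_cst.
      exact: (smooth_continuous (smooth_cosl b)).
    exact: continuous_subspaceT.
  + apply/cvgr0Pnorm_le => e e0.
    pose C := 1 + (oneDsqr b)^-1 * (`|b| + 1).
    have C0 : 0 < C.
      by rewrite ltr_wpDr// mulr_ge0 ?invr_ge0 ?(ltW (oneDsqr_gt0 _))// addr_ge0.
    have H : forall x, `|F x| <= C * expR (- x).
      move=> x; rewrite /F (le_trans (ler_normD _ _))// normrN normrM (ger0_norm (expR_ge0 _)).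
      rewrite /C mulrDl mul1r lerD2l mulrC ler_wpM2r ?expR_ge0//.
      rewrite normrM ger0_norm ?invr_ge0 ?(ltW (oneDsqr_gt0 _))//.
      rewrite ler_wpM2l ?invr_ge0 ?(ltW (oneDsqr_gt0 _))//.
      rewrite (le_trans (ler_normB _ _))// lerD ?cos_max// normrM ler_piMr// sin_max//.
    have /cvgr0Pnorm_le /(_ (e / C)) := @cvgr_expR R.
    rewrite divr_gt0// => /(_ isT) He; near=> x.
    apply: le_trans (H x) _; rewrite mulrC -ler_pdivlMr//.
    by apply: le_trans (ler_norm _) _; near: x.
  + by move=> x _; have [] := is_derive_derive1 (dF x).
  + apply: cvg_at_right_filter.
    have := derivable_continuous (fun x => (is_derive_derive1 (dF x)).1); exact.
  + by move=> x _; have [] := is_derive_derive1 (dF x).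
- by move=> x; rewrite mulr_ge0 ?laplace_ge0// -lerBlDl sub0r cos_geN1.
- move=> x; apply: cvgM; first exact: laplace_continuous.
  apply: cvgD; first exact: cvg_cst.
  exact: (smooth_continuous (smooth_cosl b)).
- by move=> x; rewrite /= /laplace normrN mulrN cosN.
Unshelve. all: by end_near. Qed.

Lemma laplace_integ : integ laplace.
Proof.
have H := laplace1Dcos_integral 0.
apply/integrableP; split.
  by apply/measurable_EFinP; apply: continuous_measurable_fun; exact: laplace_continuous.
apply: (@le_lt_trans _ _ (2 * (1 + (oneDsqr 0)^-1))%:E); last exact: ltry.
rewrite -H; apply: ge0_le_integral => //.
- by do 2!apply: measurableT_comp => //; apply: continuous_measurable_fun; exact: laplace_continuous.
- apply: measurableT_comp => //; apply: measurable_funM.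
    by apply: continuous_measurable_fun; exact: laplace_continuous.
  by apply: measurable_funD => //; exact: measurable_cosl.
- move=> x _; rewrite /= lee_fin ger0_norm ?laplace_ge0// mul0r cos0 ler_peMr ?laplace_ge0//.
  by rewrite lerDl.
Qed.

Lemma rint_laplace : rint laplace = 2.
Proof.
have H := laplace1Dcos_integral 0.
have : rint (fun x => laplace x * (1 + cos (0 * x))) = 2 * (1 + (oneDsqr 0)^-1).
  by rewrite /Rintegral H.
have -> : (fun x => laplace x * (1 + cos (0 * x))) = (fun x => 2 * laplace x).
  by apply/funext => x; rewrite mul0r cos0 mulrC.
rewrite rintZ; last exact: laplace_integ.
by rewrite /oneDsqr expr0n /= addr0 invr1; lra.
Qed.

Lemma laplace_cos (b : R) : rint (fun x => laplace x * cos (b * x)) = 2 * (oneDsqr b)^-1.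
Proof.
have : rint (fun x => laplace x * (1 + cos (b * x))) = 2 * (1 + (oneDsqr b)^-1).
  by rewrite /Rintegral laplace1Dcos_integral.
have -> : (fun x => laplace x * (1 + cos (b * x))) = (fun x => laplace x + laplace x * cos (b * x)).
  by apply/funext => x; rewrite mulrDr mulr1.
rewrite rintD; [|exact: laplace_integ|exact/integ_cosl/laplace_integ].
by rewrite rint_laplace; lra.
Qed.

(** For [b = 2 pi (xi - y)] the right side is an approximate identity in [y], concentrating at [xi]
    at width of order [1 / (n + 1)]. *)
Lemma rint_affine_laplace (b : R) (n : nat) :
  rint (fun x => laplace (n.+1%:R^-1 * x) * cos (b * x)) =
  n.+1%:R * (2 * (oneDsqr (n.+1%:R * b))^-1).
Proof.
have n0 : n.+1%:R != 0 :> R by rewrite pnatr_eq0.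
rewrite -laplace_cos.
have ml : measurable_fun setT (fun x => laplace x * cos (n.+1%:R * b * x)).
  exact: integ_measurable (integ_cosl _ laplace_integ).
have := @rint_affine R (n.+1%:R^-1) 0 _ _ ml; rewrite invr_eq0 n0 => /(_ isT).
rewrite normfV invrK normr_nat => <-; apply: eq_rint => x.
rewrite addr0; congr (_ * cos _).
by move: (n.+1%:R) n0 => N N0; field.
Qed.

Lemma cvg_laplace_scale (x : R) :
  laplace (n.+1%:R^-1 * x) @[n --> \oo] --> (1 : R).
Proof.
have l0 : laplace (0 * x) = (1 : R) by rewrite /laplace mul0r normr0 oppr0 expR0.
have H : n.+1%:R^-1 * x @[n --> \oo] --> 0 * x.
  by apply: cvgMr_tmp; exact: cvg_harmonic.
by have := continuous_cvg _ (@laplace_continuous (0 * x)) H; rewrite l0; apply.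
Qed.

Lemma rint_dominated_cvg (f_ : nat -> R -> R) (f g : R -> R) :
  (forall n, measurable_fun setT (f_ n)) -> measurable_fun setT f ->
  (forall x, f_ n x @[n --> \oo] --> f x) -> integ g ->
  (forall n x, `|f_ n x| <= g x) ->
  rint (f_ n) @[n --> \oo] --> rint f.
Proof.
move=> mf_ mf cf ig fg.
have iF n : integ (f_ n) by apply: integ_le ig _ => //.
have cE : {ae leb, forall x, setT x -> (EFin \o f_ n) x @[n --> \oo] --> (EFin \o f) x}.
  by apply: aeW => x _; apply: cvg_EFin; [exact: nearW|exact: cf].
have bE : {ae leb, forall x n, setT x -> (`|(EFin \o f_ n) x| <= (EFin \o g) x)%E}.
  by apply: aeW => x n _; rewrite /= lee_fin.
have mE n : measurable_fun setT (EFin \o f_ n) by exact/measurable_EFinP.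
have mE' : measurable_fun setT (EFin \o f) by exact/measurable_EFinP.
have [H1 _ H3] := @dominated_convergence _ _ _ leb setT measurableT
  (fun n => EFin \o f_ n) (EFin \o f) (EFin \o g) mE mE' cE ig bE.
by apply: fine_cvg; rewrite fineK ?integrable_fin_num.
Qed.

(** The double integral in [x] and [y] need not converge absolutely, so Fubini is applied after
    damping by [laplace (x / (n + 1))]. The damped integrals have two limits: [rint h], as the
    damping disappears, and [a xi], as averages of [a] concentrating at [xi]. *)
Lemma inversion a (xi : R) (h : R -> R) : test a ->
  (forall x, h x = rint (fun y => a y * cos (2 * pi * (xi - y) * x))) ->
  integ h -> rint h = a xi.
Proof.
move=> ta hE ih.
have ia := test_integ ta; have ca : continuous a by apply: smooth_continuous; case: ta.
have ma := integ_measurable ia.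
have [K K0 aK] := test_bounded ta.
have n0 n : n.+1%:R != 0 :> R by rewrite pnatr_eq0.
(* First limit: the damping factor is at most 1 and tends to 1. *)
have cl : rint (fun x => laplace (n.+1%:R^-1 * x) * h x) @[n --> \oo] --> rint h.
  apply: (@rint_dominated_cvg _ _ (fun x => `|h x|)).
  - move=> m; apply: measurable_funM; last exact: integ_measurable ih.
    apply: measurableT_comp; last exact: measurable_funM.
    by apply: continuous_measurable_fun; exact: laplace_continuous.
  - exact: integ_measurable ih.
  - move=> x; rewrite -[X in _ --> X]mul1r; apply: cvgMr_tmp; exact: cvg_laplace_scale.
  - exact: integ_norm.
  - by move=> m x; rewrite normrM ger0_norm ?laplace_ge0// ler_piMl// laplace_le1.
(* Fubini, then the substitution [y = xi + s / (n + 1)], moves all dependence on [n] into the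
   argument of [a]. *)
have E n : rint (fun x => laplace (n.+1%:R^-1 * x) * h x) =
    rint (fun s => a (n.+1%:R^-1 * s + xi) * (2 * (oneDsqr (2 * pi * s))^-1)).
  pose k (z : R * R) := cos (2 * pi * (xi - z.2) * z.1).
  have il : integ (fun x => laplace (n.+1%:R^-1 * x)).
    have := integ_affine (t := n.+1%:R^-1) 0 _ laplace_integ; rewrite invr_eq0 n0 => /(_ isT).
    by apply: eq_integ => x; rewrite addr0.
  transitivity (rint (fun x => laplace (n.+1%:R^-1 * x) * rint (fun y => a y * k (x, y)))).
    by apply: eq_rint => x; rewrite hE.
  rewrite rint_fubini//; last 2 first.
  - apply: measurableT_comp; first by apply: continuous_measurable_fun; exact: continuous_cos.
    apply: measurable_funM => //; apply: measurable_funM => //.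
    exact: measurable_funB.
  - by move=> x y; exact: cos_max.
  transitivity (rint (fun y => a y * (n.+1%:R * (2 * (oneDsqr (n.+1%:R * (2 * pi * (xi - y))))^-1)))).
    by apply: eq_rint => y; rewrite /k /= rint_affine_laplace.
  pose G y := a y * (n.+1%:R * (2 * (oneDsqr (n.+1%:R * (2 * pi * (xi - y))))^-1)).
  have mG : measurable_fun setT G.
    apply: measurable_funM => //; apply: measurable_funM => //; apply: measurable_funM => //.
    apply: (@measurableT_comp _ _ _ _ _ _ (fun x : R => (oneDsqr x)^-1)).
      by apply: continuous_measurable_fun; exact: continuous_oneDsqrV.
    by apply: measurable_funM => //; apply: measurable_funM => //; exact: measurable_funB.
  have := @rint_affine R (n.+1%:R^-1) xi G _ mG; rewrite invr_eq0 n0 => /(_ isT).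
  rewrite normfV invrK normr_nat -/G => H.
  have -> : rint G = n.+1%:R^-1 * rint (fun x => G (n.+1%:R^-1 * x + xi)).
    by rewrite H mulKf.
  have iG : integ G.
    apply: (@integ_le _ _ (fun y => (n.+1%:R * 2) * `|a y|)) => //; first exact/integZ/integ_norm.
    move=> y; rewrite /G normrM mulrC ler_wpM2r// mulrA normrM ger0_norm//.
    rewrite ler_piMr// ger0_norm ?invr_ge0 ?(ltW (oneDsqr_gt0 _))//.
    by rewrite invf_le1 ?oneDsqr_gt0// oneDsqr_ge1.
  rewrite -rintZ.
    apply: eq_rint => s; rewrite /G.
    have -> : n.+1%:R * (2 * pi * (xi - (n.+1%:R^-1 * s + xi))) = - (2 * pi * s) by move: (n.+1%:R) (n0 n) => N N0; field.
    rewrite /oneDsqr sqrrN mulrCA; congr (_ * _); rewrite mulKf//.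
  have := integ_affine (t := n.+1%:R^-1) xi _ iG; rewrite invr_eq0 n0 => /(_ isT); exact.
(* A fixed probability density. Since [a] is bounded and continuous, averaging it against [p] gives
   the second limit. *)
pose p s : R := 2 * (oneDsqr (2 * pi * s))^-1.
have tp0 : 2 * pi != 0 :> R by rewrite mulf_neq0// gt_eqF// pi_gt0.
have ip : integ p.
  apply: integZ; have := integ_affine 0 tp0 (oneDsqrV_integ R).
  by apply: eq_integ => x; rewrite addr0.
have p1 : rint p = 1.
  rewrite /p rintZ; last first.
    have := integ_affine 0 tp0 (oneDsqrV_integ R).
    by apply: eq_integ => x; rewrite addr0.
  have := @rint_affine R (2 * pi) 0 (fun x => (oneDsqr x)^-1) tp0 (integ_measurable (oneDsqrV_integ R)).
  under eq_rint do rewrite addr0.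
  move=> ->; rewrite /Rintegral oneDsqrV_integral /= gtr0_norm ?mulr_gt0 ?pi_gt0//.
  have pi0 : pi != 0 :> R by rewrite gt_eqF// pi_gt0.
  by move: (pi) pi0 => P P0; field.
have c2 : rint (fun s => a (n.+1%:R^-1 * s + xi) * p s) @[n --> \oo] --> rint (fun s => a xi * p s).
  apply: (@rint_dominated_cvg _ _ (fun x => K * `|p x|)).
  - move=> m; apply: measurable_funM; last exact: integ_measurable ip.
    by apply: measurableT_comp => //; exact: measurable_affine.
  - by apply: measurable_funM => //; exact: integ_measurable ip.
  - move=> x; apply: cvgMr_tmp.
    have H : n.+1%:R^-1 * x + xi @[n --> \oo] --> 0 * x + xi.
      by apply: cvgD; [apply: cvgMr_tmp; exact: cvg_harmonic|exact: cvg_cst].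
    have -> : a xi = a (0 * x + xi) by rewrite mul0r add0r.
    exact: (continuous_cvg _ (@ca (0 * x + xi)) H).
  - by apply: integZ; exact: integ_norm.
  - by move=> m x; rewrite normrM ler_wpM2r.
rewrite rintZ// p1 mulr1 in c2.
have cl' : rint (fun s => a (n.+1%:R^-1 * s + xi) * p s) @[n --> \oo] --> rint h.
  by under eq_fun do rewrite -E.
exact: (cvg_unique _ cl' c2).
Qed.

End Inversion.

(** * Packets and their norms *)
Section Packets.
Variable R : realType.
Local Notation leb := (@lebesgue_measure R).
Local Notation rint f := (Rintegral leb setT f).
Local Notation integ f := (leb.-integrable setT (EFin \o f)).
Implicit Types (a b f g : R -> R).

Lemma fcfs_cos a x xi : integ a ->
  fc a x * cos (2 * pi * x * xi) + fs a x * sin (2 * pi * x * xi) =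
  rint (fun y => a y * cos (2 * pi * (xi - y) * x)).
Proof.
move=> ia; rewrite mulrC (mulrC (fs a x)) -rintZ; last exact: integ_cosl.
rewrite -(rintZ _ (integ_sinl _ ia)) -rintD; last 2 first.
- exact/integZ/integ_cosl.
- exact/integZ/integ_sinl.
apply: eq_rint => y.
have -> : 2 * pi * (xi - y) * x = 2 * pi * x * xi - 2 * pi * x * y by ring.
by rewrite cosB; ring.
Qed.

Lemma fcN a x : fc a (- x) = fc a x.
Proof. by apply: eq_rint => y; rewrite mulrN mulNr cosN. Qed.

Lemma fsN a x : integ a -> fs a (- x) = - fs a x.
Proof.
move=> ia; rewrite -[RHS]mulN1r -rintZ; last exact: integ_sinl.
by apply: eq_rint => y; rewrite mulrN mulNr sinN mulN1r mulrN.
Qed.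

Lemma itest_fc a : test a -> itest (fc a).
Proof.
move=> ta; exists a, (fun y => 0 * a y); split=> //; first exact: testZ.
move=> x; rewrite [X in _ + X](_ : _ = 0) ?addr0//.
by rewrite -[RHS](mul0r (fs a x)) -rintZ; [apply: eq_rint => y; rewrite mulrA|exact/integ_sinl/test_integ].
Qed.

Lemma itest_fs a : test a -> itest (fs a).
Proof.
move=> ta; exists (fun y => 0 * a y), a; split=> //; first exact: testZ.
move=> x; rewrite [X in X + _](_ : _ = 0) ?add0r//.
by rewrite -[RHS](mul0r (fc a x)) -rintZ; [apply: eq_rint => y; rewrite mulrA|exact/integ_cosl/test_integ].
Qed.

Lemma itestD f g : itest f -> itest g -> itest (fun x => f x + g x).
Proof.
move=> [a [b [ta tb fE]]] [c [d [tc td gE]]].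
exists (fun y => a y + c y), (fun y => b y + d y); split; [exact: testD..|].
move=> x; rewrite fcD ?fsD; [|exact: test_integ..].
by rewrite fE gE addrACA.
Qed.

Lemma itestZ (c : R) f : itest f -> itest (fun x => c * f x).
Proof.
move=> [a [b [ta tb fE]]].
exists (fun y => c * a y), (fun y => c * b y); split; [exact: testZ..|].
move=> x; rewrite fE mulrDr /fc /fs -(rintZ _ (integ_cosl _ (test_integ ta))).
rewrite -(rintZ _ (integ_sinl _ (test_integ tb))).
by congr (_ + _); apply: eq_rint => y; rewrite mulrA.
Qed.

Lemma itest_integ_cos f (t : R) : itest f -> integ (fun x => f x * cos (2 * pi * x * t)).
Proof.
move=> tf; apply: eq_integ (integ_cosl (2 * pi * t) (itest_integ tf)) => x /=.
by rewrite (mulrAC _ x).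
Qed.

Lemma itest_integ_sin f (t : R) : itest f -> integ (fun x => f x * sin (2 * pi * x * t)).
Proof.
move=> tf; apply: eq_integ (integ_sinl (2 * pi * t) (itest_integ tf)) => x /=.
by rewrite (mulrAC _ x).
Qed.

Lemma fcfs_inversion a xi : test a ->
  rint (fun x => fc a x * cos (2 * pi * x * xi) + fs a x * sin (2 * pi * x * xi)) = a xi.
Proof.
move=> ta; apply: inversion => //; first by move=> x; rewrite fcfs_cos//; exact: test_integ.
by apply: integD; [exact/itest_integ_cos/itest_fc|exact/itest_integ_sin/itest_fs].
Qed.

(** This is the imaginary part of the inversion integral. For real [a] the cosine transform is even
    and the sine transform odd, so the integrand is odd. *)
Lemma fcfs_odd a xi : test a ->
  rint (fun x => fs a x * cos (2 * pi * x * xi) - fc a x * sin (2 * pi * x * xi)) = 0.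
Proof.
move=> ta.
have ii : integ (fun x => fs a x * cos (2 * pi * x * xi) - fc a x * sin (2 * pi * x * xi)).
  by apply: integB; [exact/itest_integ_cos/itest_fs|exact/itest_integ_sin/itest_fc].
apply: rint_odd => //; first exact: integ_measurable ii.
move=> x; rewrite fcN fsN; last exact: test_integ.
by rewrite !mulrN !mulNr cosN sinN; ring.
Qed.

(* inverse Fourier transform of [a + i b] *)
Definition ift a b (x : R) : R[i] :=
  Complex (fc a x - fs b x) (fs a x + fc b x).

Lemma fourier_ift a b xi : test a -> test b ->
  fourier (ift a b) xi = Complex (a xi) (b xi).
Proof.
move=> ta tb; rewrite /fourier /cint.
have [ica isa] := (itest_integ_cos xi (itest_fc ta), itest_integ_sin xi (itest_fs ta)).
have [icb isb] := (itest_integ_cos xi (itest_fc tb), itest_integ_sin xi (itest_fs tb)).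
have [ica' isa'] := (itest_integ_cos xi (itest_fs ta), itest_integ_sin xi (itest_fc ta)).
have [icb' isb'] := (itest_integ_cos xi (itest_fs tb), itest_integ_sin xi (itest_fc tb)).
congr Complex.
- rewrite -[RHS]subr0 -(fcfs_inversion xi ta) -(fcfs_odd xi tb) -rintB; last 2 first.
  + exact: integD.
  + exact: integB.
  by apply: eq_rint => x; rewrite /= cosN sinN; ring.
- rewrite -[RHS]addr0 -(fcfs_inversion xi tb) -(fcfs_odd xi ta) -rintD; last 2 first.
  + exact: integD.
  + exact: integB.
  by apply: eq_rint => x; rewrite /= cosN sinN; ring.
Qed.

Lemma classP_ift a b : test a -> test b -> classP (ift a b).
Proof.
move=> ta tb; split; first apply: schwartz_itest => /=.
- have := itestD (itest_fc ta) (itestZ (-1) (itest_fs tb)).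
  by under [X in itest X]eq_fun do rewrite mulN1r.
- exact: itestD (itest_fs ta) (itest_fc tb).
- split.
    split.
    + under [X in continuous X]eq_fun do rewrite fourier_ift//.
      by apply: smooth_continuous; case: ta.
    + under [X in continuous X]eq_fun do rewrite fourier_ift//.
      by apply: smooth_continuous; case: tb.
  have [_ [L aL]] := ta; have [_ [K bK]] := tb.
  exists (Num.max L K) => xi; rewrite gt_max => /andP[Lx Kx].
  by rewrite fourier_ift// aL// bK.
Qed.

(* [packet t a s] is the inverse Fourier transform of [bump (t (y - a)) e^(-2 pi i s y)]:
   scale [t] in space, frequency [a], position [s] *)
Definition packetr (t a s y : R) : R := bump (t * (y - a)) * cos (2 * pi * s * y).
Definition packeti (t a s y : R) : R := - (bump (t * (y - a)) * sin (2 * pi * s * y)).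
Definition packet (t a s : R) : R -> R[i] := ift (packetr t a s) (packeti t a s).

Lemma test_bump_affine (t a : R) : t != 0 -> test (fun y : R => bump (t * (y - a))).
Proof.
move=> t0; have := test_affine (- (t * a)) t0 (@test_bump R).
by under [X in test X]eq_fun do rewrite -mulrBr.
Qed.

Lemma test_packetr (t a s : R) : t != 0 -> test (packetr t a s).
Proof.
by move=> t0; apply: testM; [exact: test_bump_affine|exact: smooth_cosl].
Qed.

Lemma test_packeti (t a s : R) : t != 0 -> test (packeti t a s).
Proof.
move=> t0; have := testZ (-1) (testM (test_bump_affine a t0) (smooth_sinl (2 * pi * s))).
by under [X in test X]eq_fun do rewrite mulN1r.
Qed.

Lemma classP_packet (t a s : R) : t != 0 -> classP (packet t a s).
Proof. by move=> t0; apply: classP_ift; [exact: test_packetr|exact: test_packeti]. Qed.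

Lemma fourier_packet (t a s xi : R) : t != 0 -> fourier (packet t a s) xi =
  Complex (bump (t * (xi - a)) * cos (2 * pi * s * xi))
          (- (bump (t * (xi - a)) * sin (2 * pi * s * xi))).
Proof.
by move=> t0; rewrite /packet fourier_ift//; [exact: test_packetr|exact: test_packeti].
Qed.

Lemma packet_Re (t a s x : R) : t != 0 -> complex.Re (packet t a s x) =
  rint (fun y => bump (t * (y - a)) * cos (2 * pi * (x - s) * y)).
Proof.
move=> t0; have [tr ti] := (test_packetr a s t0, test_packeti a s t0).
rewrite /= -rintB; [|exact/integ_cosl/test_integ|exact/integ_sinl/test_integ].
apply: eq_rint => y; rewrite /packetr /packeti.
have -> : 2 * pi * (x - s) * y = 2 * pi * x * y - 2 * pi * s * y by ring.
by rewrite cosB; ring.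
Qed.

Lemma packet_Im (t a s x : R) : t != 0 -> complex.Im (packet t a s x) =
  rint (fun y => bump (t * (y - a)) * sin (2 * pi * (x - s) * y)).
Proof.
move=> t0; have [tr ti] := (test_packetr a s t0, test_packeti a s t0).
rewrite /= -rintD; [|exact/integ_sinl/test_integ|exact/integ_cosl/test_integ].
apply: eq_rint => y; rewrite /packetr /packeti.
have -> : 2 * pi * (x - s) * y = 2 * pi * x * y - 2 * pi * s * y by ring.
by rewrite sinB; ring.
Qed.

Lemma bump_integ : integ (@bump R). Proof. exact/test_integ/test_bump. Qed.

Lemma rint_bump_affine (t a : R) (k : R -> R) : 0 < t ->
  measurable_fun setT (fun y => bump y * k (t^-1 * y + a)) ->
  rint (fun y => bump (t * (y - a)) * k y) = t^-1 * rint (fun y => bump y * k (t^-1 * y + a)).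
Proof.
move=> t0 mk; have tn0 : t != 0 by rewrite gt_eqF.
rewrite -[X in X^-1 * _](gtr0_norm t0) -(@rint_affine _ t (- (t * a)))//.
apply: eq_rint => y; congr (bump _ * k _); first by rewrite mulrBr.
by rewrite mulrBr !mulKf// subrK.
Qed.

(** Substituting [y / t + a] shows that a packet is [t^-1] times a number of modulus 1 times the
    inverse transform of [bump] at [(x - s) / t]. One constant therefore serves all [t], [a] and
    [s]. *)
Lemma packet_bound : exists2 K : R, 0 <= K & forall t a s x : R, 0 < t ->
  cmod (packet t a s x) <= t^-1 * (K * (oneDsqr (t^-1 * x - t^-1 * s))^-1).
Proof.
have tb := @test_bump R.
have [K1 K10 H1] := itest_le (itest_fc tb); have [K2 K20 H2] := itest_le (itest_fs tb).
exists (2 * (K1 + K2)); first by rewrite mulr_ge0 ?addr_ge0.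
move=> t a s x t0; have tn0 : t != 0 by rewrite gt_eqF.
(* [u] is the position relative to [s] in units of the scale; [ph] is the modulation caused by the
   frequency [a]. *)
pose u := t^-1 * x - t^-1 * s; pose ph := 2 * pi * (x - s) * a.
have ib := bump_integ.
have Ec y : cos (2 * pi * (x - s) * (t^-1 * y + a)) =
    cos (2 * pi * u * y) * cos ph - sin (2 * pi * u * y) * sin ph.
  by rewrite -cosD; congr cos; rewrite /u /ph; ring.
have Es y : sin (2 * pi * (x - s) * (t^-1 * y + a)) =
    sin (2 * pi * u * y) * cos ph + cos (2 * pi * u * y) * sin ph.
  by rewrite -sinD; congr sin; rewrite /u /ph; ring.
have iC : integ (fun y : R => bump y * cos (2 * pi * u * y)) by exact: integ_cosl.
have iS : integ (fun y : R => bump y * sin (2 * pi * u * y)) by exact: integ_sinl.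
have ER : complex.Re (packet t a s x) = t^-1 * (cos ph * fc (@bump R) u - sin ph * fs (@bump R) u).
  have E : (fun y : R => bump y * cos (2 * pi * (x - s) * (t^-1 * y + a))) =
    (fun y => cos ph * (bump y * cos (2 * pi * u * y)) - sin ph * (bump y * sin (2 * pi * u * y))).
    by apply/funext => y; rewrite Ec; ring.
  have iE := integB (integZ (cos ph) iC) (integZ (sin ph) iS).
  rewrite packet_Re// (@rint_bump_affine t a (fun y => cos (2 * pi * (x - s) * y)))//.
    by rewrite E rintB ?rintZ//; exact: integZ.
  by rewrite E; exact: integ_measurable iE.
have EI : complex.Im (packet t a s x) = t^-1 * (cos ph * fs (@bump R) u + sin ph * fc (@bump R) u).
  have E : (fun y : R => bump y * sin (2 * pi * (x - s) * (t^-1 * y + a))) =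
    (fun y => cos ph * (bump y * sin (2 * pi * u * y)) + sin ph * (bump y * cos (2 * pi * u * y))).
    by apply/funext => y; rewrite Es; ring.
  have iE := integD (integZ (cos ph) iS) (integZ (sin ph) iC).
  rewrite packet_Im// (@rint_bump_affine t a (fun y => sin (2 * pi * (x - s) * y)))//.
    by rewrite E rintD ?rintZ//; exact: integZ.
  by rewrite E; exact: integ_measurable iE.
have cm (z : R[i]) : cmod z <= `|complex.Re z| + `|complex.Im z|.
  rewrite /cmod -[leRHS]ger0_norm ?addr_ge0// -sqrtr_sqr ler_wsqrtr//.
  rewrite sqrrD !real_normK ?num_real// addrAC lerDl mulrn_wge0// mulr_ge0//.
apply: le_trans (cm _) _; rewrite ER EI !normrM ger0_norm ?invr_ge0 ?(ltW t0)//.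
rewrite -mulrDr ler_wpM2l ?invr_ge0 ?(ltW t0)//.
have B (p q : R) : `|p| <= 1 -> `|q| <= 1 -> forall v w : R, `|p * v| + `|q * w| <= `|v| + `|w|.
  by move=> p1 q1 v w; rewrite !normrM lerD// ler_piMl.
have e1 := le_trans (ler_normB _ _) (B _ _ (cos_max ph) (sin_max ph) (fc (@bump R) u) (fs (@bump R) u)).
have e2 := le_trans (ler_normD _ _) (B _ _ (cos_max ph) (sin_max ph) (fs (@bump R) u) (fc (@bump R) u)).
have h1 := H1 u; have h2 := H2 u; rewrite -/u.
set V := (oneDsqr u)^-1 in h1 h2 *.
have -> : 2 * (K1 + K2) * V = K1 * V + K2 * V + (K2 * V + K1 * V) by ring.
lra.
Qed.

Lemma packet_measurable (t a s : R) : t != 0 -> measurable_fun setT (fun x => cmod (packet t a s x)).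
Proof.
move=> t0; have [tr ti] := (test_packetr a s t0, test_packeti a s t0).
have mR : measurable_fun setT (fun x => complex.Re (packet t a s x)).
  by apply: measurable_funB; apply: continuous_measurable_fun; apply: itest_continuous;
    [exact: itest_fc|exact: itest_fs].
have mI : measurable_fun setT (fun x => complex.Im (packet t a s x)).
  by apply: measurable_funD; apply: continuous_measurable_fun; apply: itest_continuous;
    [exact: itest_fs|exact: itest_fc].
apply: (@measurableT_comp _ _ _ _ _ _ (@Num.sqrt R)).
  by apply: continuous_measurable_fun; exact: sqrt_continuous.
by apply: measurable_funD; exact: measurable_funX.
Qed.

(** At exponent [+oo], [Lnorm] is an essential supremum only if the whole space has positive
    measure. *)
Lemma lebT_gt0 : (0 < leb [set: R])%E.
Proof.
apply: (@lt_le_trans _ _ (leb `[(0:R), 1]%classic)).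
  by rewrite lebesgue_measure_itv /= lte_fin ltr01 -EFinB subr0 lte_fin ltr01.
by apply: le_measure => //; rewrite inE.
Qed.

(** The profile [V] of [packet_bound] satisfies [V <= 1], hence [V^r <= V] for [r >= 1]. So the
    single integral of [V], equal to [t pi], handles every finite exponent, and [V <= 1] handles
    [+oo], where [einv] is 0. *)
Lemma Lpnorm_packet (p : \bar R) : (1 <= p)%E ->
  exists2 K : R, 0 <= K & forall t a s : R, 0 < t ->
  (Lpnorm p (packet t a s) <= (K * t `^ (einv p - 1))%:E)%E.
Proof.
have [K K0 HK] := packet_bound; case: p => [r||] //; last first.
  move=> _; exists K => // t a s t0; rewrite /Lpnorm unlock /=.
  rewrite lebT_gt0.
  apply/ess_supP; apply: nearW => x; rewrite /= lee_fin ger0_norm ?sqrtr_ge0//.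
  rewrite sub0r (powR_inv1 (ltW t0)); apply: (le_trans (HK t a s x t0)).
  rewrite [leRHS]mulrC ler_wpM2l ?invr_ge0 ?(ltW t0)// ler_piMr//.
  by rewrite invf_le1 ?oneDsqr_gt0// oneDsqr_ge1.
rewrite lee_fin => r1; have r0 : 0 < r by rewrite (lt_le_trans ltr01).
exists (K * pi `^ r^-1); first by rewrite mulr_ge0 ?powR_ge0.
move=> t a s t0; have tn0 : t^-1 != 0 by rewrite invr_eq0 gt_eqF.
rewrite /Lpnorm unlock /=.
pose V x := (oneDsqr (t^-1 * x - t^-1 * s))^-1.
have V0 x : 0 <= V x by rewrite invr_ge0 ltW// oneDsqr_gt0.
have V1 x : V x <= 1 by rewrite invf_le1 ?oneDsqr_gt0// oneDsqr_ge1.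
have mV : measurable_fun setT V.
  apply: (@measurableT_comp _ _ _ _ _ _ (fun x : R => (oneDsqr x)^-1)).
    by apply: continuous_measurable_fun; exact: continuous_oneDsqrV.
  exact: measurable_affine.
have IV : (\int[leb]_x (V x)%:E = (t * pi)%:E)%E.
  rewrite (@ge0_integral_affine R t^-1 (- (t^-1 * s)) (fun x => ((oneDsqr x)^-1)%:E))//; last first.
  - by apply/measurable_EFinP; apply: continuous_measurable_fun; exact: continuous_oneDsqrV.
  by rewrite oneDsqrV_integral normfV invrK gtr0_norm// -EFinM.
pose D := (t^-1 * K) `^ r.
have H1 x : (cmod (packet t a s x)) `^ r <= D * V x.
  apply: (@le_trans _ _ ((t^-1 * K * V x) `^ r)).
    apply: ge0_ler_powR; rewrite ?nnegrE ?sqrtr_ge0 ?(ltW r0)//.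
      by rewrite !mulr_ge0 ?invr_ge0 ?(ltW t0).
    by rewrite -mulrA; exact: HK.
  rewrite powRM ?mulr_ge0 ?invr_ge0 ?(ltW t0)// ler_wpM2l ?powR_ge0//.
  by apply: ge1r_powR => //; rewrite V1 andbT invr_gt0 oneDsqr_gt0.
have H2 : (\int[leb]_x `|(cmod (packet t a s x))%:E| `^ r <= (D * (t * pi))%:E)%E.
  rewrite EFinM -IV -ge0_integralZl//; last 3 first.
  - exact/measurable_EFinP.
  - by move=> x _; rewrite lee_fin.
  - by rewrite lee_fin powR_ge0.
  apply: ge0_le_integral => //.
  - by move=> x _; exact: poweR_ge0.
  - apply: (measurableT_comp (measurable_poweR r)); apply: measurableT_comp => //.
    apply/measurable_EFinP; apply: packet_measurable; by rewrite gt_eqF.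
  - by apply/measurable_EFinP; apply: measurable_funM.
  - move=> x _; rewrite -EFinM /= ger0_norm ?sqrtr_ge0//.
    by rewrite lee_fin.
have I0 : (0 <= \int[leb]_x `|(cmod (packet t a s x))%:E| `^ r)%E.
  by apply: integral_ge0 => x _; exact: poweR_ge0.
apply: (@le_trans _ _ ((D * (t * pi))%:E `^ r^-1)%E).
  apply: gt0_ler_poweR => //.
  - by rewrite invr_ge0 ltW.
  - by rewrite in_itv /= I0 leey.
  - by rewrite in_itv /= leey andbT; exact: le_trans I0 H2.
have tp : 0 <= t * pi by rewrite mulr_ge0 ?pi_ge0// ltW.
rewrite poweR_EFin lee_fin powRM ?powR_ge0// /D -powRrM mulfV ?gt_eqF// powRr1; last first.
  by rewrite mulr_ge0// invr_ge0 ltW.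
rewrite powRM ?pi_ge0 ?(ltW t0)// powRD; last by rewrite (gt_eqF t0) implybT.
rewrite (powR_inv1 (ltW t0)) le_eqVlt; apply/orP; left; apply/eqP.
by ring.
Qed.

End Packets.

(** * Injectivity of the Fourier transform *)
Section Injectivity.
Variable R : realType.
Local Notation leb := (@lebesgue_measure R).
Local Notation rint f := (Rintegral leb setT f).
Local Notation integ f := (leb.-integrable setT (EFin \o f)).
Implicit Types (a b f g : R -> R).

Lemma rint_gt0 f (x : R) : continuous f -> integ f -> (forall y, 0 <= f y) -> 0 < f x ->
  0 < rint f.
Proof.
move=> cf fi f0 fx.
have fx2 : f x / 2 < f x by rewrite ltr_pdivrMr// ltr_pMr// ltr1n.
have /cvgr_gt /(_ _ fx2) := cf x.
move=> /nbhs_ballP[d /= d0 Hd].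
pose I := `[x - d / 2, x + d / 2]%classic : set R.
pose g (y : R) := f x / 2 * \1_I y.
have mI : measurable I by exact: measurable_itv.
have lI : leb I = d%:E.
  rewrite /I lebesgue_measure_itv /= lte_fin.
  rewrite ifT; last by lra.
  by rewrite -EFinB; congr EFin; lra.
have i1 : integ (\1_I : R -> R).
  exact: integrable_indic_itv.
have rg : rint g = f x / 2 * d.
  rewrite /g rintZ; last exact: i1.
  congr (_ * _).
  by rewrite /Rintegral integral_indic// setIT -[RHS]/(fine d%:E) -lI.
apply: (@lt_le_trans _ _ (rint g)); first by rewrite rg mulr_gt0// divr_gt0.
apply: le_rint => //; first exact: integZ.
move=> y; rewrite /g indicE; case: (boolP (y \in I)) => yI; last by rewrite mulr0.
rewrite mulr1 ltW//; apply: Hd; rewrite /ball /=.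
by move: yI; rewrite inE /I /= in_itv /= ltr_distlC => /andP[? ?]; lra.
Qed.

(** By inversion a test function is a superposition of cosines and sines, so Fubini puts the
    vanishing transforms of [h] in play and [h] is orthogonal to all test functions. A bump placed
    where [h] keeps a strict sign contradicts this. *)
Lemma fcfs_eq0 (h : R -> R) : continuous h -> integ h ->
  (forall x, fc h x = 0) -> (forall x, fs h x = 0) -> h = (fun=> 0).
Proof.
move=> ch ih hc hs.
have P (k : R -> R) (B : R) : continuous k -> (forall y, `|k y| <= B) -> integ (fun y => h y * k y).
    move=> ck kB; apply: (@integ_le _ _ (fun y => B * `|h y|)).
    - by apply: measurable_funM; exact: continuous_measurable_fun.
    - exact/integZ/integ_norm.
    - by move=> y; rewrite normrM mulrC ler_wpM2r.
have Pb b : test b -> integ (fun y => h y * b y).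
  move=> tb; have [B _ bB] := test_bounded tb; apply: (P _ B) => //.
  by apply: smooth_continuous; case: tb.
have K b : test b -> rint (fun y => h y * b y) = 0.
  move=> tb.
  have ic := itest_integ (itest_fc tb); have is_ := itest_integ (itest_fs tb).
  have ib := test_integ tb.
  have E y : b y = rint (fun x => fc b x * cos (2 * pi * x * y)) + rint (fun x => fs b x * sin (2 * pi * x * y)).
    rewrite -[LHS](fcfs_inversion y tb) rintD//.
      exact/itest_integ_cos/itest_fc.
    exact/itest_integ_sin/itest_fs.
  have mk : measurable_fun setT (fun z : R * R => 2 * pi * z.2 * z.1).
    by apply: measurable_funM => //; apply: measurable_funM.
  have H1 : rint (fun y => h y * rint (fun x => fc b x * cos (2 * pi * x * y))) = 0.
    rewrite (@rint_fubini R h (fc b) (fun z => cos (2 * pi * z.2 * z.1)))//.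
    - rewrite (_ : (fun x => _) = (fun x => 0 * fc b x)) ?rintZ ?mul0r//.
      apply/funext => x /=; by rewrite [X in _ * X = _](hc x) mulr0 mul0r.
    - by apply: measurableT_comp => //; apply: continuous_measurable_fun; exact: continuous_cos.
    - by move=> x y; exact: cos_max.
  have H2 : rint (fun y => h y * rint (fun x => fs b x * sin (2 * pi * x * y))) = 0.
    rewrite (@rint_fubini R h (fs b) (fun z => sin (2 * pi * z.2 * z.1)))//.
    - rewrite (_ : (fun x => _) = (fun x => 0 * fs b x)) ?rintZ ?mul0r//.
      apply/funext => x /=; by rewrite [X in _ * X = _](hs x) mulr0 mul0r.
    - by apply: measurableT_comp => //; apply: continuous_measurable_fun; exact: continuous_sin.
    - by move=> x y; exact: sin_max.
  have Fc (y : R) : rint (fun x => fc b x * cos (2 * pi * x * y)) = fc (fc b) y.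
    by apply: eq_rint => x; rewrite (mulrAC _ x).
  have Fs (y : R) : rint (fun x => fs b x * sin (2 * pi * x * y)) = fs (fs b) y.
    by apply: eq_rint => x; rewrite (mulrAC _ x).
  have cb : continuous b by apply: smooth_continuous; case: tb.
  have cbN : continuous (fun y => b (- y)).
    by move=> y; apply: (@continuous_comp _ _ _ (fun y => - y) b); [exact: opp_continuous|exact: cb].
  have [B _ bB] := test_bounded tb.
  (* The cosine and sine parts of the inversion formula are the even and odd parts of [b]. Being
     continuous and bounded, they have integrable products with [h], which justifies splitting the
     integral. *)
  have Ec y : fc (fc b) y = 2^-1 * (b y + b (- y)).
    by rewrite (E y) (E (- y)) !Fc !Fs fcN fsN//; field.
  have Es y : fs (fs b) y = 2^-1 * (b y + (- b (- y))).
    by rewrite (E y) (E (- y)) !Fc !Fs fcN fsN//; field.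
  have -> : (fun y => h y * b y) = (fun y => h y * rint (fun x => fc b x * cos (2 * pi * x * y))
     + h y * rint (fun x => fs b x * sin (2 * pi * x * y))).
    by apply/funext => y; rewrite {1}E mulrDr.
  rewrite rintD ?H1 ?H2 ?addr0//.
  - apply: (P _ B).
      under [X in continuous X]eq_fun do rewrite Fc Ec.
      by move=> y; apply: cvgMl_tmp; apply: cvgD; [exact: cb|exact: cbN].
    move=> y; rewrite Fc Ec normrM ger0_norm ?invr_ge0// mulrC ler_pdivrMr//.
    by rewrite (le_trans (ler_normD _ _))// mulr_natr mulr2n lerD.
  - apply: (P _ B).
      under [X in continuous X]eq_fun do rewrite Fs Es.
      by move=> y; apply: cvgMl_tmp; apply: cvgD; [exact: cb|apply: cvgN; exact: cbN].
    move=> y; rewrite Fs Es normrM ger0_norm ?invr_ge0// mulrC ler_pdivrMr//.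
    by rewrite (le_trans (ler_normD _ _))// normrN mulr_natr mulr2n lerD.
(* Stated for a general [g] because it is applied to [h] and to [- h]. *)
have key (g : R -> R) (x : R) : continuous g -> 0 < g x ->
   (forall b, test b -> rint (fun y => g y * b y) = 0) -> False.
  move=> cg gx gb.
  have /cvgr_gt /(_ _ gx) := cg x.
  move=> /nbhs_ballP[d /= d0 Hd].
  have dn0 : d^-1 != 0 by rewrite invr_eq0 gt_eqF.
  have tb := test_bump_affine x dn0.
  have cb : continuous (fun y : R => bump (d^-1 * (y - x))) by apply: smooth_continuous; case: tb.
  have bz y : d <= `|y - x| -> bump (d^-1 * (y - x)) = 0.
    move=> H; apply: bump_eq0; rewrite normrM ger0_norm ?invr_ge0 ?(ltW d0)//.
    by rewrite mulrC ler_pdivlMr// mul1r.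
  have cgb : continuous (fun y : R => g y * bump (d^-1 * (y - x))).
    by move=> y; apply: cvgM; [exact: cg|exact: cb].
  have : 0 < rint (fun y => g y * bump (d^-1 * (y - x))).
    apply: (@rint_gt0 _ x) => //.
    - apply: (@continuous_support_integ _ _ (`|x| + d)) => // y Hy; rewrite bz ?mulr0//.
      have := ler_normB y (y - x); have : y - (y - x) = x by ring.
      move=> ->; have := ler_normD (y - x) x; rewrite subrK; lra.
    - move=> y; have [H|H] := leP d `|y - x|; first by rewrite bz ?mulr0.
      rewrite mulr_ge0 ?bump_ge0// ltW//; apply: Hd.
      by rewrite /ball /= distrC.
    - by rewrite subrr mulr0 mulr_gt0// bump0_gt0.
  by rewrite gb// ltxx.
apply/funext => x; have [hx|hx|//] := ltgtP (h x) 0.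
- case: (key (fun y => -1 * h y) x).
  + by move=> y; apply: cvgM; [exact: cvg_cst|exact: ch].
  + by rewrite mulN1r oppr_gt0.
  + move=> b tb; rewrite -[RHS](mulr0 (-1)) -(K b tb) -rintZ; last exact: Pb.
    by apply: eq_rint => y; rewrite mulrA.
- by case: (key h x).
Qed.

End Injectivity.

(** * Lower bounds for the bilinear operator on packets *)
Section LowerBounds.
Variable R : realType.
Local Notation leb := (@lebesgue_measure R).
Local Notation rint f := (Rintegral leb setT f).
Local Notation integ f := (leb.-integrable setT (EFin \o f)).
Implicit Types (a b f g : R -> R).

(** [J1] and [J2] will be the real and imaginary parts of the integrand of [B_M]. The product
    majorant makes all iterated integrals converge, so a pointwise minorant can be integrated in one
    variable at a time. *)
Lemma lower_double (J1 J2 : R * R -> R) (u v : R -> R) (c1 c2 : R)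
    (r : R -> R -> R) (r' : R -> R) :
  measurable_fun setT J1 -> measurable_fun setT J2 -> integ u -> integ v ->
  (forall y x, `|J1 (y, x)| <= `|u y| * `|v x|) ->
  (forall y x, `|J2 (y, x)| <= `|u y| * `|v x|) ->
  (forall y, integ (r y)) -> (forall y x, r y x <= c1 * J1 (y, x) + c2 * J2 (y, x)) ->
  integ r' -> (forall y, r' y <= rint (r y)) ->
  rint r' <= c1 * rint (fun y => rint (fun x => J1 (y, x))) +
             c2 * rint (fun y => rint (fun x => J2 (y, x))).
Proof.
move=> m1 m2 iu iv b1 b2 ir rJ ir' r'r.
have sec (J : R * R -> R) : measurable_fun setT J -> (forall y x, `|J (y, x)| <= `|u y| * `|v x|) ->
    forall y, integ (fun x => J (y, x)).
  move=> mJ bJ y; apply: (@integ_le _ _ (fun x => `|u y| * `|v x|)) => //.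
    by apply: measurableT_comp => //; exact: pair1_measurable.
  exact/integZ/integ_norm.
have [s1 s2] := (sec _ m1 b1, sec _ m2 b2).
have [i1 _] := product_integ_section (product_integ_le m1 iu iv b1) s1.
have [i2 _] := product_integ_section (product_integ_le m2 iu iv b2) s2.
rewrite -!rintZ// -rintD; [|exact: integZ|exact: integZ].
apply: le_rint => //; first by apply: integD; exact: integZ.
move=> y; apply: le_trans (r'r y) _; rewrite -!rintZ// -rintD; [|exact: integZ|exact: integZ].
by apply: le_rint => //; apply: integD; exact: integZ.
Qed.

(** The left side is the real part of [z] times the conjugate of [c1 + i c2]. With the expected
    limit as [c1 + i c2], a lower bound for one real integral bounds [cmod z] below. *)
Lemma cmod_lower (z : R[i]) (c1 c2 : R) :
  c1 * complex.Re z + c2 * complex.Im z <= (`|c1| + `|c2|) * cmod z.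
Proof.
have hR : `|complex.Re z| <= cmod z.
  by rewrite /cmod -sqrtr_sqr ler_wsqrtr// lerDl sqr_ge0.
have hI : `|complex.Im z| <= cmod z.
  by rewrite /cmod -sqrtr_sqr ler_wsqrtr// lerDr sqr_ge0.
rewrite (le_trans (ler_norm _))// (le_trans (ler_normD _ _))// !normrM mulrDl.
by rewrite lerD// ler_wpM2l.
Qed.

Variable M : R -> R[i].
Hypothesis cM : ccontinuous M.

(* real and imaginary parts of [M(u) e^(-2 pi i s u)] *)
Definition twistr (s u : R) : R :=
  complex.Re (M u) * cos (2 * pi * s * u) + complex.Im (M u) * sin (2 * pi * s * u).
Definition twisti (s u : R) : R :=
  complex.Im (M u) * cos (2 * pi * s * u) - complex.Re (M u) * sin (2 * pi * s * u).

Lemma twistr_continuous s : continuous (twistr s).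
Proof.
have [c1 c2] := cM; move=> u; apply: cvgD; apply: cvgM;
  [exact: c1|exact: (smooth_continuous (smooth_cosl _))
  |exact: c2|exact: (smooth_continuous (smooth_sinl _))].
Qed.

Lemma twisti_continuous s : continuous (twisti s).
Proof.
have [c1 c2] := cM; move=> u; apply: cvgB; apply: cvgM;
  [exact: c2|exact: (smooth_continuous (smooth_cosl _))
  |exact: c1|exact: (smooth_continuous (smooth_sinl _))].
Qed.

Definition weight (t a y x : R) : R := bump (t * (x - a)) * bump (t * (y + a)).
Definition phase (y x z : R) : R := 2 * pi * (x + y) * z.

(** The modulations [e^(-2 pi i s x)] and [e^(2 pi i s y)] multiply to a function of [x - y] alone,
    so they merge with the symbol. *)
Lemma BM_packet (t a s z : R) : t != 0 ->
  BM M (packet t a s) (packet t (- a) (- s)) z =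
  Complex (rint (fun y => rint (fun x => weight t a y x *
             (twistr s (x - y) * cos (phase y x z) - twisti s (x - y) * sin (phase y x z)))))
          (rint (fun y => rint (fun x => weight t a y x *
             (twistr s (x - y) * sin (phase y x z) + twisti s (x - y) * cos (phase y x z))))).
Proof.
move=> t0; rewrite /BM /cint.
have E x y : fourier (packet t a s) x * fourier (packet t (- a) (- s)) y * M (x - y) *
    expi (2 * pi * (x + y) * z) =
  Complex (weight t a y x *
     (twistr s (x - y) * cos (phase y x z) - twisti s (x - y) * sin (phase y x z)))
    (weight t a y x *
     (twistr s (x - y) * sin (phase y x z) + twisti s (x - y) * cos (phase y x z))).
  rewrite !fourier_packet// /twistr /twisti /weight /expi -/(phase y x z) opprK.
  have -> : 2 * pi * s * (x - y) = 2 * pi * s * x - 2 * pi * s * y by ring.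
  have -> : 2 * pi * - s * y = - (2 * pi * s * y) by ring.
  rewrite cosB sinB cosN sinN.
  move: (bump (t * (x - a))) (bump (t * (y + a))) (cos (2 * pi * s * x)) (sin (2 * pi * s * x))
    (cos (2 * pi * s * y)) (sin (2 * pi * s * y)) (cos (phase y x z)) (sin (phase y x z))
    => b1 b2 k1 l1 k2 l2 k3 l3.
  case: (M (x - y)) => m1 m2 /=.
  by congr Complex => /=; ring.
by congr Complex; apply: eq_rint => y /=; apply: eq_rint => x; rewrite E.
Qed.

Lemma continuous_bounded f (L : R) : continuous f ->
  exists2 K : R, 0 <= K & forall x, `|x| <= L -> `|f x| <= K.
Proof.
move=> cf; have [L0|L0] := ltP L 0.
  by exists 0 => // x xL; have := le_lt_trans xL L0; rewrite normr_lt0.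
have [||c _ Hc] := @EVT_max R (fun x => `|f x|) (-L) L; first by lra.
  by apply: continuous_subspaceT => x; apply: continuous_comp; [exact: cf|exact: norm_continuous].
exists `|f c| => // x xL.
by apply: Hc; rewrite in_itv /= -ler_norml.
Qed.

Lemma weight_eq0 (t a y x : R) : 0 < t -> ~~ ((`|x - a| < t^-1) && (`|y + a| < t^-1)) ->
  weight t a y x = 0.
Proof.
move=> t0; rewrite negb_and -!leNgt /weight => /orP[] H.
  rewrite bump_eq0 ?mul0r// normrM gtr0_norm// mulrC -ler_pdivrMr// div1r//.
rewrite mulrC bump_eq0 ?mul0r// normrM gtr0_norm// mulrC -ler_pdivrMr// div1r//.
Qed.

Lemma weight_ge0 (t a y x : R) : 0 <= weight t a y x.
Proof. by rewrite mulr_ge0 ?bump_ge0. Qed.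

Lemma measurable_weight (t a : R) : t != 0 -> measurable_fun setT (fun w : R * R => weight t a w.1 w.2).
Proof.
move=> t0; have mb : measurable_fun setT (@bump R).
  by apply: continuous_measurable_fun; apply: smooth_continuous; case: (@test_bump R).
by apply: measurable_funM; apply: measurableT_comp => //; apply: measurable_funM => //;
  [exact: measurable_funB|exact: measurable_funD].
Qed.

Lemma measurable_diff f : continuous f -> measurable_fun setT (fun w : R * R => f (w.2 - w.1)).
Proof.
move=> cf; apply: measurableT_comp; first exact: continuous_measurable_fun.
exact: measurable_funB.
Qed.

Lemma measurable_phase f (z : R) : continuous f ->
  measurable_fun setT (fun w : R * R => f (phase w.1 w.2 z)).
Proof.
move=> cf; apply: measurableT_comp; first exact: continuous_measurable_fun.
by apply: measurable_funM => //; apply: measurable_funM => //; exact: measurable_funD.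
Qed.

(** The integrand is the real part of [c1 - i c2] times the twisted symbol times [e^(i phase)]. On
    the support of the weight [x - y] stays bounded, hence so does the twisted symbol, and the two
    bumps provide the product majorant. *)
Lemma BM_packet_lower (t a s z c1 c2 : R) (r : R -> R -> R) (r' : R -> R) : 0 < t ->
  (forall y, integ (r y)) ->
  (forall y x, r y x <= weight t a y x *
    ((c1 * twistr s (x - y) + c2 * twisti s (x - y)) * cos (phase y x z) +
     (c2 * twistr s (x - y) - c1 * twisti s (x - y)) * sin (phase y x z))) ->
  integ r' -> (forall y, r' y <= rint (r y)) ->
  rint r' <= (`|c1| + `|c2|) * cmod (BM M (packet t a s) (packet t (- a) (- s)) z).
Proof.
move=> t0 ir rJ ir' r'r; have tn0 : t != 0 by rewrite gt_eqF.
apply: le_trans (cmod_lower _ _ _); rewrite BM_packet//=.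
(* The radius comes from [x - y = (x - a) - (y + a) + 2 a], where both brackets are below [t^-1] on
   the support. *)
have [K1 K10 H1] := continuous_bounded (2 * `|a| + 2 * t^-1) (@twistr_continuous s).
have [K2 K20 H2] := continuous_bounded (2 * `|a| + 2 * t^-1) (@twisti_continuous s).
have ib (b : R) : integ (fun y : R => bump (t * (y - b))) by exact/test_integ/test_bump_affine.
have bound (A : R -> R -> R) : (forall y x, `|A y x| <= `|twistr s (x - y)| + `|twisti s (x - y)|) ->
    forall y x, `|weight t a y x * A y x| <=
    `|bump (t * (y + a))| * `|(K1 + K2) * bump (t * (x - a))|.
  move=> HA y x; case: (boolP ((`|x - a| < t^-1) && (`|y + a| < t^-1))) => [/andP[xa ya]|H]; last first.
    by rewrite (weight_eq0 t0 H) mul0r normr0 mulr_ge0.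
  have Hxy : `|x - y| <= 2 * `|a| + 2 * t^-1.
    have -> : x - y = (x - a) - (y + a) + 2 * a by ring.
    rewrite (le_trans (ler_normD _ _))// addrC lerD//; first by rewrite normrM ger0_norm.
    by rewrite (le_trans (ler_normB _ _))// mulr_natl mulr2n lerD// ltW.
  have HK : `|A y x| <= K1 + K2 by apply: le_trans (HA y x) _; rewrite lerD ?H1 ?H2.
  rewrite (normrM (weight t a y x)) (normrM (bump (t * (x - a)))) (normrM (K1 + K2)) (ger0_norm (addr_ge0 K10 K20)).
  have -> : `|bump (t * (y + a))| * ((K1 + K2) * `|bump (t * (x - a))|) =
     `|bump (t * (x - a))| * `|bump (t * (y + a))| * (K1 + K2) by ring.
  by rewrite ler_wpM2l// mulr_ge0.
have tri (p q A B : R) : `|p| <= 1 -> `|q| <= 1 -> `|A * p| + `|B * q| <= `|A| + `|B|.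
  by move=> p1 q1; rewrite !normrM lerD// ler_piMr.
have mw := @measurable_weight t a tn0.
have mr := measurable_diff (@twistr_continuous s).
have mi := measurable_diff (@twisti_continuous s).
have mc := measurable_phase z (@continuous_cos R).
have ms := measurable_phase z (@continuous_sin R).
apply: (@lower_double
  (fun w => weight t a w.1 w.2 * (twistr s (w.2 - w.1) * cos (phase w.1 w.2 z)
                                  - twisti s (w.2 - w.1) * sin (phase w.1 w.2 z)))
  (fun w => weight t a w.1 w.2 * (twistr s (w.2 - w.1) * sin (phase w.1 w.2 z)
                                  + twisti s (w.2 - w.1) * cos (phase w.1 w.2 z)))
  (fun y => bump (t * (y + a))) (fun x => (K1 + K2) * bump (t * (x - a))) c1 c2 r r') => //.
- by apply: measurable_funM => //; apply: measurable_funB; exact: measurable_funM.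
- by apply: measurable_funM => //; apply: measurable_funD; exact: measurable_funM.
- by have := ib (- a); under eq_fun do rewrite opprK.
- exact: integZ.
- apply: (bound (fun y x => twistr s (x - y) * cos (phase y x z) - twisti s (x - y) * sin (phase y x z))).
  by move=> y x; rewrite (le_trans (ler_normB _ _))// tri// ?cos_max ?sin_max.
- apply: (bound (fun y x => twistr s (x - y) * sin (phase y x z) + twisti s (x - y) * cos (phase y x z))).
  by move=> y x; rewrite (le_trans (ler_normD _ _))// tri// ?cos_max ?sin_max.
- move=> y x; apply: le_trans (rJ y x) _; rewrite /= le_eqVlt; apply/orP; left; apply/eqP.
  by ring.
Qed.

Lemma rint_bump_gt0 : 0 < rint (@bump R).
Proof.
apply: (@rint_gt0 _ _ 0).
- by apply: smooth_continuous; case: (@test_bump R).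
- exact: bump_integ.
- exact: bump_ge0.
- exact: bump0_gt0.
Qed.

Lemma rint_affineB (t a : R) f : 0 < t -> measurable_fun setT f ->
  rint (fun y => f (t * (y - a))) = t^-1 * rint f.
Proof.
move=> t0 mf; rewrite -[X in X^-1 * _](gtr0_norm t0) -(@rint_affine _ t (- (t * a)))//.
  by apply: eq_rint => y; rewrite mulrBr.
by rewrite gt_eqF.
Qed.

(* Large scale: on the support of the packets the symbol is close to [M (2 a)]. *)
Lemma BM_large_scale (a : R) : M (2 * a) <> 0 ->
  exists d rho t0 : R, [/\ 0 < d, 0 < rho, 0 < t0 & forall t z, t0 <= t -> `|z| <= rho * t ->
    d * t ^- 2 <= cmod (BM M (packet t a 0) (packet t (- a) (- 0)) z)].
Proof.
move=> Ma; set m1 := complex.Re (M (2 * a)); set m2 := complex.Im (M (2 * a)).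
pose mu := m1 ^+ 2 + m2 ^+ 2.
have mu0 : 0 < mu.
  rewrite lt_neqAle addr_ge0 ?sqr_ge0// andbT eq_sym paddr_eq0 ?sqr_ge0// !sqrf_eq0.
  apply/negP => /andP[/eqP h1 /eqP h2]; apply: Ma.
  by move: h1 h2; rewrite /m1 /m2; case: (M (2 * a)) => ? ? /= -> ->.
have tw0 u : twistr 0 u = complex.Re (M u) by rewrite /twistr mulr0 mul0r cos0 sin0; ring.
have ti0 u : twisti 0 u = complex.Im (M u) by rewrite /twisti mulr0 mul0r cos0 sin0; ring.
(* [U] and [- V] are the real and imaginary parts of the symbol times the conjugate of [M (2 a)]; at
   [2 a] they equal [mu] and 0. *)
pose U u := m1 * twistr 0 u + m2 * twisti 0 u.
pose V u := m2 * twistr 0 u - m1 * twisti 0 u.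
have cU : continuous U.
  by move=> u; apply: cvgD; apply: cvgMl_tmp; [exact: twistr_continuous|exact: twisti_continuous].
have cV : continuous V.
  by move=> u; apply: cvgB; apply: cvgMl_tmp; [exact: twistr_continuous|exact: twisti_continuous].
have U0 : U (2 * a) = mu by rewrite /U tw0 ti0 -/m1 -/m2 /mu; ring.
have V0 : V (2 * a) = 0 by rewrite /V tw0 ti0 -/m1 -/m2; ring.
(* The thresholds give [U cos >= 3 mu / 8] and [V sin >= - mu / 4], leaving [mu / 8]. *)
have [e1 e10 He1] : exists2 e : R, 0 < e & forall u, `|u - 2 * a| < e -> 3 / 4 * mu < U u.
  have lt1 : 3 / 4 * mu < U (2 * a) by rewrite U0; lra.
  have /cvgr_gt /(_ _ lt1) /nbhs_ballP[e /= e0 He] := cU (2 * a).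
  by exists e => // u ue; apply: He; rewrite /ball /= distrC.
have [e2 e20 He2] : exists2 e : R, 0 < e & forall u, `|u - 2 * a| < e -> `|V u| < mu / 4.
  have lt1 : 0 < mu / 4 by lra.
  have := cV (2 * a); rewrite /continuous_at V0 => /cvgr0_norm_lt /(_ _ lt1) /nbhs_ballP[e /= e0 He].
  by exists e => // u ue; apply: He; rewrite /ball /= distrC.
have [e3 e30 He3] : exists2 e : R, 0 < e & forall th : R, `|th| < e -> 2^-1 < cos th.
  have lt1 : 2^-1 < cos (0 : R) by rewrite cos0; lra.
  have /cvgr_gt /(_ _ lt1) /nbhs_ballP[e /= e0 He] := @continuous_cos R 0.
  by exists e => // u ue; apply: He; rewrite /ball /= sub0r normrN.
pose I := rint (@bump R); have I0 : 0 < I by exact: rint_bump_gt0.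
have C0 : 0 < `|m1| + `|m2|.
  rewrite lt_neqAle addr_ge0// andbT eq_sym paddr_eq0// !normr_eq0.
  by apply: contraL mu0 => /andP[/eqP h1 /eqP h2]; rewrite /mu h1 h2 expr0n /= addr0 ltxx.
have pi0 := @pi_gt0 R.
(* [rho] gives [|phase| <= 2 pi (2 / t) (rho t) = e3 / 2], and the threshold [4 / min e1 e2] gives
   [2 / t < min e1 e2]. The factor [I^2 t^-2] comes from integrating the two bumps. *)
exists (mu / 8 * I ^+ 2 / (`|m1| + `|m2|)), (e3 / (8 * pi)), (4 / Num.min e1 e2).
have emin : 0 < Num.min e1 e2 by rewrite lt_min e10.
split.
- by rewrite !mulr_gt0// ?invr_gt0// ?exprn_gt0//; lra.
- by rewrite divr_gt0// mulr_gt0.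
- by rewrite divr_gt0.
move=> t z tt0 zt; have t0 : 0 < t by rewrite (lt_le_trans _ tt0)// divr_gt0.
have tV : t^-1 * 4 <= Num.min e1 e2.
  by rewrite ler_pdivrMl// mulrC -ler_pdivrMl// mulrC.
have -> : mu / 8 * I ^+ 2 / (`|m1| + `|m2|) / t ^+ 2 = mu / 8 * I ^+ 2 / t ^+ 2 / (`|m1| + `|m2|).
  by rewrite mulrAC.
rewrite ler_pdivrMr// [leRHS]mulrC.
have mb : measurable_fun setT (@bump R) by exact: (integ_measurable (@bump_integ R)).
have ib (b : R) : integ (fun y : R => bump (t * (y - b))).
  by apply/test_integ/test_bump_affine; rewrite gt_eqF.
pose r y x := mu / 8 * bump (t * (y + a)) * bump (t * (x - a)).
pose r' y := mu / 8 * t^-1 * I * bump (t * (y - - a)).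
have -> : mu / 8 * I ^+ 2 / t ^+ 2 = rint r'.
  rewrite /r' rintZ; last exact: ib.
  by rewrite rint_affineB// -/I; field; rewrite gt_eqF.
apply: (@BM_packet_lower t a 0 z m1 m2 r r') => //.
- by move=> y; apply: integZ; exact: ib.
- move=> y x; case: (boolP ((`|x - a| < t^-1) && (`|y + a| < t^-1))) => [/andP[xa ya]|H]; last first.
    have := weight_eq0 t0 H; rewrite /r /weight -mulrA (mulrC (bump (t * (y + a)))) => ->.
    by rewrite mulr0 mul0r.
  have -> : r y x = weight t a y x * (mu / 8) by rewrite /r /weight; ring.
  apply: ler_wpM2l; first exact: weight_ge0.
  rewrite -/(U (x - y)) -/(V (x - y)).
  have ti : 0 < t^-1 by rewrite invr_gt0.
  have Hu : `|x - y - 2 * a| < Num.min e1 e2.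
    have -> : x - y - 2 * a = (x - a) - (y + a) by ring.
    apply: le_lt_trans (ler_normB _ _) _; lra.
  move: Hu; rewrite lt_min => /andP[/He1 HU /He2 HV].
  have Hp : `|phase y x z| < e3.
    rewrite /phase !normrM (ger0_norm (ltW pi0)) ger0_norm//.
    have -> : x + y = (x - a) + (y + a) by ring.
    have h1 : `|x - a + (y + a)| < 2 * t^-1 by apply: le_lt_trans (ler_normD _ _) _; lra.
    apply: (@le_lt_trans _ _ (2 * pi * (2 * t^-1) * (e3 / (8 * pi) * t))).
      by rewrite ler_pM ?mulr_ge0 ?(ltW pi0)// ler_wpM2l ?mulr_ge0 ?(ltW pi0)// ltW.
    have -> : 2 * pi * (2 * t^-1) * (e3 / (8 * pi) * t) = e3 / 2.
      by move: (pi) pi0 => P P0; field; rewrite ?(gt_eqF t0) ?(gt_eqF P0).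
    by lra.
  have Hc := He3 _ Hp; have Hs := sin_max (phase y x z).
  have h1 : 3 / 8 * mu <= U (x - y) * cos (phase y x z).
    apply: (@le_trans _ _ (3 / 4 * mu * 2^-1)); first by lra.
    by apply: ler_pM; lra.
  have h2 : - (mu / 4) <= V (x - y) * sin (phase y x z).
    rewrite lerNl (le_trans (ler_norm _))// normrN normrM.
    by rewrite -[leRHS]mulr1 ler_pM// ltW.
  by lra.
- exact/integZ/ib.
- move=> y; rewrite /r rintZ; last exact: ib.
  rewrite rint_affineB// -/I /r' opprK; lra.
Qed.

Lemma lipschitz f (f' : R -> R) (K : R) : (forall x, is_derive (x : R) (1 : R) f (f' x)) ->
  (forall x, `|f' x| <= K) -> forall x y, `|f x - f y| <= K * `|x - y|.
Proof.
move=> df f'K; have K0 : 0 <= K by apply: le_trans (f'K 0).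
have cf : continuous f by apply: derivable_continuous => x; have [] := is_derive_derive1 (df x).
suff H x y : x <= y -> `|f y - f x| <= K * `|y - x|.
  move=> x y; have [|/ltW] := leP x y; last exact: H.
  by rewrite distrC (distrC x); exact: H.
move=> xy; have [c _ ->] := @MVT_segment R f f' x y xy (fun x _ => df x)
   (continuous_subspaceT cf).
by rewrite normrM ler_wpM2r.
Qed.

(** The Lipschitz bound tends to 0 with [t] for fixed [x - y], and the constant [B] keeps the error
    dominated when [x - y] is large. *)
Lemma bump_small_scale (t B L : R) : 0 < t -> (forall x : R, bump x <= B) ->
  (forall x y : R, `|bump x - bump y| <= L * `|x - y|) ->
  forall x y, `|bump (t * (x - 0)) - bump (t * (y + 0))| <= Num.min B (L * t * `|x - y|).
Proof.
move=> t0 bB bL x y; rewrite le_min; apply/andP; split.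
  rewrite ler_norml; have := bB (t * (x - 0)); have := bB (t * (y + 0)).
  by have := bump_ge0 (t * (x - 0)); have := bump_ge0 (t * (y + 0)); lra.
apply: le_trans (bL _ _) _.
have -> : t * (x - 0) - t * (y + 0) = t * (x - y) by ring.
by rewrite normrM gtr0_norm// mulrA.
Qed.

(* Small scale: after rescaling the symbol acts like the constant [int M(u) e^(-2 pi i s u) du]
   times a point mass on the diagonal. *)
Lemma BM_small_scale (s : R) : integ (twistr s) -> integ (twisti s) ->
  (rint (twistr s) != 0) || (rint (twisti s) != 0) ->
  exists d rho : R, exists n0 : nat, [/\ 0 < d, 0 < rho & forall n z, (n0 <= n)%N ->
    `|z| <= rho * n.+1%:R^-1 ->
    d * n.+1%:R <= cmod (BM M (packet n.+1%:R^-1 0 s) (packet n.+1%:R^-1 (- 0) (- s)) z)].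
Proof.
move=> ir ii m0; set m1 := rint (twistr s) in m0 *; set m2 := rint (twisti s) in m0 *.
pose mu := m1 ^+ 2 + m2 ^+ 2.
have mu0 : 0 < mu.
  rewrite lt_neqAle addr_ge0 ?sqr_ge0// andbT eq_sym paddr_eq0 ?sqr_ge0// !sqrf_eq0.
  by rewrite negb_and.
have C0 : 0 < `|m1| + `|m2|.
  rewrite lt_neqAle addr_ge0// andbT eq_sym paddr_eq0// !normr_eq0.
  by rewrite negb_and.
(* Here the pairing is with the conjugate of [m1 + i m2], the integral of the twisted symbol, so
   that [U] has integral [mu]. *)
pose U u := m1 * twistr s u + m2 * twisti s u.
pose V u := m2 * twistr s u - m1 * twisti s u.
have iU : integ U by apply: integD; exact: integZ.
have iV : integ V by apply: integB; exact: integZ.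
have rU : rint U = mu.
  rewrite /U rintD; [|exact: integZ|exact: integZ].
  by rewrite !rintZ// -/m1 -/m2 /mu; ring.
pose W u : R := `|U u| + `|V u|.
have iW : integ W by apply: integD; exact: integ_norm.
have W0 u : 0 <= W u by rewrite addr_ge0.
have rW0 : 0 <= rint W by apply: Rintegral_ge0.
have tb := @test_bump R; have tb' := test_derive1 tb.
have [B B0 Bb] := test_bounded tb; have [L L0 Lb] := test_bounded tb'.
have bB x : bump x <= B by apply: le_trans (ler_norm _) (Bb x).
have Bp : 0 < B by apply: lt_le_trans (bB 0); exact: bump0_gt0.
have bL : forall x y : R, `|bump x - bump y| <= L * `|x - y|.
  apply: (@lipschitz _ (derive1 (@bump R))) => // x.
  by apply: derivable_is_derive1; apply: smooth_derivable; case: tb.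
(* Majorant, at [u = x - y], of the error made by replacing [bump (t x)] with [bump (t y)]; its
   integral tends to 0 by dominated convergence with bound [B W]. *)
pose E (n : nat) (u : R) : R := W u * Num.min B (L * n.+1%:R^-1 * `|u|).
have mE n : measurable_fun setT (E n).
  apply: measurable_funM; first exact: integ_measurable iW.
  by apply: measurable_minr => //; apply: measurable_funM => //.
have nV (n : nat) : 0 < n.+1%:R^-1 :> R by rewrite invr_gt0 ltr0n.
have min0 n u : 0 <= Num.min B (L * n.+1%:R^-1 * `|u|).
  by rewrite le_min B0 !mulr_ge0 ?(ltW (nV n)).
have E0 n u : 0 <= E n u by rewrite mulr_ge0.
have EB n u : `|E n u| <= B * W u.
  by rewrite (ger0_norm (E0 n u)) /E (mulrC B) ler_wpM2l// ge_min lexx.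
have iE n : integ (E n) by apply: integ_le (mE n) _ (EB n); exact: integZ.
have cE : rint (E n) @[n --> \oo] --> (0 : R).
  have -> : (0 : R) = rint (fun x : R => 0 * W x) by rewrite rintZ// mul0r.
  apply: (@rint_dominated_cvg _ _ _ (fun u => B * W u)) => //; last exact: integZ.
    by apply: measurable_funM => //; exact: integ_measurable iW.
  move=> u; rewrite mul0r; apply: (@squeeze_cvgr _ _ _ _ (fun=> 0) (fun n => (W u * L * `|u|) * n.+1%:R^-1)).
  - apply: nearW => n; rewrite E0/= /E -!mulrA ler_wpM2l//.
    by rewrite ge_min; apply/orP; right; rewrite (mulrC `|u|).
  - exact: cvg_cst.
  - by rewrite -[X in _ --> X](mulr0 (W u * L * `|u|)); apply: cvgMl_tmp; exact: cvg_harmonic.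
pose I := rint (@bump R); have I0 : 0 < I by exact: rint_bump_gt0.
have tb2 : test (fun x : R => bump x * bump x) by apply: testM => //; case: tb.
pose I2 := rint (fun x : R => bump x * bump x).
have I20 : 0 < I2.
  apply: (@rint_gt0 _ _ 0) => //.
  - by apply: smooth_continuous; case: tb2.
  - exact: test_integ.
  - by move=> y; rewrite mulr_ge0 ?bump_ge0.
  - by rewrite mulr_gt0 ?bump0_gt0.
(* Total error allowed per unit of [bump]: [kap I] is half of the main term [mu I2]. *)
pose kap := mu * I2 / (2 * I).
have kap0 : 0 < kap by rewrite divr_gt0// mulr_gt0.
have pi0 := @pi_gt0 R.
(* The phase is at most [2 pi (2 / t) (rho t) = 4 pi rho], so removing it costs at most [C W]. This
   [rho] gives [C] times the integral of [W] at most [kap / 2]; the added 1 keeps the denominator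
   positive. *)
pose rho := kap / (8 * pi * B * (rint W + 1)).
have rW1 : 0 < rint W + 1 by rewrite ltr_wpDl.
have rho0 : 0 < rho by rewrite divr_gt0// !mulr_gt0.
pose C := 4 * pi * rho * B.
have Cp : 0 <= C.
  by apply: ltW; apply: mulr_gt0 => //; apply: mulr_gt0 => //; apply: mulr_gt0.
have CW : C * rint W <= kap / 2.
  have -> : C * rint W = kap / 2 * (rint W / (rint W + 1)).
    rewrite /C /rho; move: (pi) pi0 (rint W) rW1 => P P0 w w1.
    by field; rewrite ?(gt_eqF P0) ?(gt_eqF Bp) ?(gt_eqF w1).
  have : rint W / (rint W + 1) <= 1 by rewrite ler_pdivrMr// mul1r lerDl.
  by move=> h; rewrite -[leRHS]mulr1 ler_wpM2l// ltW// divr_gt0.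
have k2 : 0 < kap / 2 by rewrite divr_gt0.
have /cvgr_lt /(_ _ k2) [n0 _ Hn0] := cE.
exists (mu * I2 / 2 / (`|m1| + `|m2|)), rho, n0; split=> //.
  by rewrite !divr_gt0// mulr_gt0.
move=> n z n0n zr; set t : R := n.+1%:R^-1.
have t0 : 0 < t by exact: nV.
have En : rint (E n) <= kap / 2 by apply/ltW/Hn0.
have -> : n.+1%:R = t^-1 :> R by rewrite invrK.
rewrite mulrAC ler_pdivrMr// [leRHS]mulrC.
pose b y : R := bump (t * (y - - 0)).
have ib : integ b by apply/test_integ/test_bump_affine; rewrite gt_eqF.
have rb : rint b = t^-1 * I.
  by rewrite /b rint_affineB//; exact: integ_measurable (@bump_integ R).
have ib2 : integ (fun y => b y * b y).
  by apply/test_integ/testM; [|apply: (proj1 _)]; apply: test_bump_affine; rewrite gt_eqF.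
have rb2 : rint (fun y => b y * b y) = t^-1 * I2.
  rewrite /b (@rint_affineB t (- 0) (fun y => bump y * bump y))//.
  exact: integ_measurable (test_integ tb2).
(* By translation invariance the integral in [x] no longer sees [y] except through [b y]: [U]
   becomes [mu], and the two errors cost at most [kap / 2] each. *)
pose r y x := b y * (b y * U (x - y) - (E n (x - y) + C * W (x - y))).
pose r' y := mu * (b y * b y) - kap * b y.
have ir' : integ r' by apply: integB; exact: integZ.
have -> : mu * I2 / 2 / t = rint r'.
  rewrite /r' rintB ?rintZ ?rb ?rb2//; [|exact: integZ|exact: integZ].
  by rewrite /kap; field; rewrite ?(gt_eqF t0) ?(gt_eqF I0).
have iEC : integ (fun u => E n u + C * W u) by apply: integD => //; exact: integZ.
have iS y : integ (fun x => b y * U (x - y) - (E n (x - y) + C * W (x - y))).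
  apply: integB; first by apply: integZ; exact: (integ_shift (- y) iU).
  exact: (integ_shift (- y) iEC).
apply: (@BM_packet_lower t 0 s z m1 m2 r r') => //.
- by move=> y; exact: integZ.
- move=> y x; rewrite -/(U (x - y)) -/(V (x - y)).
  have bE : b y = bump (t * (y + 0)) by rewrite /b opprK.
  have -> : weight t 0 y x = b y * bump (t * (x - 0)) by rewrite /weight bE mulrC.
  rewrite /r -mulrA; set bx := bump (t * (x - 0)).
  have bx0 : 0 <= bx by exact: bump_ge0.
  have by0 : 0 <= b y by exact: bump_ge0.
  (* Outside the support of [b] both sides vanish; inside it [|y| < t^-1], which the phase estimate
     uses. *)
  have [y1|y1] := leP t^-1 `|y|.
    rewrite bE bump_eq0 ?mul0r// addr0 normrM gtr0_norm// mulrC -ler_pdivrMr// div1r//.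
  apply: ler_wpM2l => //.
  have h1 : `|(bx - b y) * U (x - y)| <= E n (x - y).
    rewrite normrM mulrC /E; apply: ler_pM => //; first by rewrite lerDl.
    by rewrite bE; exact: bump_small_scale.
  have h2 : `|bx * (U (x - y) * (cos (phase y x z) - 1) + V (x - y) * sin (phase y x z))|
     <= C * W (x - y).
    have [x1|x1] := leP t^-1 `|x|.
      rewrite /bx bump_eq0; first by rewrite mul0r normr0 mulr_ge0.
      rewrite subr0 normrM gtr0_norm// mulrC -ler_pdivrMr// div1r//.
    have Hp : `|phase y x z| <= 4 * pi * rho.
      rewrite /phase !normrM (ger0_norm (ltW pi0)) ger0_norm//.
      have h1' : `|x + y| <= 2 * t^-1 by apply: le_trans (ler_normD _ _) _; lra.
      apply: (@le_trans _ _ (2 * pi * (2 * t^-1) * (rho * t))).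
        by rewrite ler_pM ?mulr_ge0 ?(ltW pi0)// ler_wpM2l ?mulr_ge0 ?(ltW pi0).
      rewrite le_eqVlt; apply/orP; left; apply/eqP.
      by move: (pi) => P; field; rewrite ?(gt_eqF t0).
    have hc : `|cos (phase y x z) - 1| <= 4 * pi * rho.
      apply: le_trans Hp; rewrite -[X in `|_ - X|]cos0.
      have := @lipschitz (@cos R) (fun u => - sin u) 1 (@is_derive_cos R) _ (phase y x z) 0.
      rewrite mul1r subr0; apply; move=> u; rewrite normrN; exact: sin_max.
    have hs : `|sin (phase y x z)| <= 4 * pi * rho.
      apply: le_trans Hp.
      have := @lipschitz (@sin R) (@cos R) 1 (@is_derive_sin R) (@cos_max R) (phase y x z) 0.
      by rewrite mul1r sin0 !subr0.
    rewrite normrM (ger0_norm bx0).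
    have -> : C * W (x - y) = B * (W (x - y) * (4 * pi * rho)) by rewrite /C; ring.
    apply: ler_pM => //; first exact: bB.
    apply: le_trans (ler_normD _ _) _; rewrite !normrM /W mulrDl.
    by rewrite lerD// ler_wpM2l.
  have h3 := le_trans (ler_norm (- _)) (eq_ind_r (fun v => v <= _) h1 (normrN _)).
  have h4 := le_trans (ler_norm (- _)) (eq_ind_r (fun v => v <= _) h2 (normrN _)).
  (* Main term on the diagonal, error [h1] from changing the bump, and error [h2] from removing the
     phase. *)
  have -> : bx * (U (x - y) * cos (phase y x z) + V (x - y) * sin (phase y x z)) =
    b y * U (x - y) + (bx - b y) * U (x - y) +
    bx * (U (x - y) * (cos (phase y x z) - 1) + V (x - y) * sin (phase y x z)) by ring.
  lra.
- move=> y; rewrite /r rintZ// rintB; last 2 first.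
  + by apply: integZ; exact: (integ_shift (- y) iU).
  + exact: (integ_shift (- y) iEC).
  rewrite rintZ; last exact: (integ_shift (- y) iU).
  rewrite (@rint_shift _ (- y) U (integ_measurable iU)).
  rewrite (@rint_shift _ (- y) (fun u => E n u + C * W u) (integ_measurable iEC)).
  rewrite rU rintD//; last exact: integZ.
  rewrite rintZ// /r'.
  have -> : mu * (b y * b y) - kap * b y = b y * (b y * mu - kap) by ring.
  apply: ler_wpM2l; first exact: bump_ge0.
  by rewrite lerD2l lerN2 [leRHS]splitr lerD.
Qed.

End LowerBounds.

(** * Comparison of exponents *)
Section Exponents.
Variable R : realType.
Local Notation leb := (@lebesgue_measure R).
Local Notation rint f := (Rintegral leb setT f).
Local Notation integ f := (leb.-integrable setT (EFin \o f)).

(* Both integrals are suprema over the simple functions below the integrand. *)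
Lemma ge0_le_integralT (f g : R -> \bar R) : (forall x, 0 <= f x)%E ->
  (forall x, f x <= g x)%E -> (\int[leb]_x f x <= \int[leb]_x g x)%E.
Proof.
move=> f0 fg; have g0 x : (0 <= g x)%E by apply: le_trans (f0 x) (fg x).
rewrite !ge0_integralTE//; apply: le_ereal_sup => _ [h hf <-].
by exists h => // x; apply: le_trans (hf x) (fg x).
Qed.

(** For finite [p] the integrand [cmod (F x)^p] is compared with [d^p] on an interval of length
    [2 r]. The argument covers [p < 1], where [Lpnorm] is not a norm. *)
Lemma Lpnorm_lower (p : \bar R) (F : R -> R[i]) (d r : R) : (0 < p)%E -> 0 < d -> 0 < r ->
  (forall z, `|z| <= r -> d <= cmod (F z)) ->
  ((d * (2 * r) `^ (einv p))%:E <= Lpnorm p F)%E.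
Proof.
move=> p0 d0 r0 HF; pose I := `[- r, r]%classic : set R.
have mI : measurable I by exact: measurable_itv.
have r2 : 0 < 2 * r by rewrite mulr_gt0.
have lI : leb I = (2 * r)%:E.
  rewrite /I lebesgue_measure_itv /= lte_fin ifT; last by lra.
  by rewrite -EFinB; congr EFin; ring.
have IP z : z \in I -> `|z| <= r by rewrite inE /I /= in_itv /= ler_norml.
case: p p0 => [p||] // p0; rewrite /Lpnorm unlock /=; last first.
  rewrite lebT_gt0 powRr0 mulr1 leNgt; apply/negP => Hlt.
  (* If the essential supremum were below [d], the interval would lie in the null set [N]. *)
  have [N [mN N0 HN]] := ess_sup_ge leb (abse \o (fun x => (cmod (F x))%:E)).
  have IN : I `<=` N.
    move=> z zI; apply: HN => /= Hz.
    have := le_lt_trans Hz Hlt; rewrite lte_fin ltNge ger0_norm ?sqrtr_ge0//.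
    by rewrite HF// IP// inE.
  have : (leb I <= leb N)%E by apply: le_measure; rewrite ?inE.
  by rewrite lI N0 lee_fin leNgt r2.
rewrite lte_fin in p0.
have H : ((d `^ p * (2 * r))%:E <= \int[leb]_x `|(cmod (F x))%:E| `^ p)%E.
  have -> : ((d `^ p * (2 * r))%:E = \int[leb]_x (d `^ p * \1_I x)%:E)%E.
    under eq_integral do rewrite EFinM.
    rewrite ge0_integralZl//; last 2 first.
    - exact/measurable_EFinP/measurable_indic.
    - by rewrite lee_fin powR_ge0.
    by rewrite integral_indic// setIT EFinM -lI.
  apply: ge0_le_integralT => x; first by rewrite lee_fin mulr_ge0 ?powR_ge0.
  rewrite indicE; case: (boolP (x \in I)) => xI; last by rewrite mulr0 poweR_ge0.
  rewrite mulr1 /= ger0_norm ?sqrtr_ge0// lee_fin.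
  by apply: ge0_ler_powR; rewrite ?nnegrE ?sqrtr_ge0 ?(ltW p0) ?(ltW d0)// HF// IP.
apply: (@le_trans _ _ ((d `^ p * (2 * r))%:E `^ p^-1)%E).
  rewrite poweR_EFin lee_fin [leRHS]powRM ?powR_ge0 ?(ltW r2)// -powRrM mulfV ?gt_eqF// powRr1//.
  exact: ltW.
have h0 : (0 <= (d `^ p * (2 * r))%:E)%E by rewrite lee_fin mulr_ge0 ?powR_ge0// ltW.
apply: gt0_ler_poweR => //.
- by rewrite invr_ge0 ltW.
- by rewrite in_itv /= h0 leey.
- by rewrite in_itv /= leey andbT; exact: le_trans h0 H.
Qed.

(** If [a > b], then [n.+1%:R ^ (a - b)] would stay below [D / c] for all large [n], yet it is
    unbounded. *)
Lemma powR_growth (a b c D : R) (n0 : nat) : 0 < c ->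
  (forall n, (n0 <= n)%N -> c * n.+1%:R `^ a <= D * n.+1%:R `^ b) -> a <= b.
Proof.
move=> c0 H; rewrite leNgt; apply/negP => ba.
have e0 : 0 < a - b by rewrite subr_gt0.
pose X := `|D / c| + 1; have X0 : 0 < X by rewrite ltr_wpDl.
have [n Hn] : exists n : nat, X `^ (a - b)^-1 < n%:R.
  exists (Num.trunc (X `^ (a - b)^-1)).+1; exact: truncnS_gt.
pose N := maxn n n0; have n0N : (n0 <= N)%N by exact: leq_maxr.
have HN : X `^ (a - b)^-1 < N.+1%:R.
  by apply: lt_le_trans Hn _; rewrite ler_nat leqW// leq_maxl.
have N0 : 0 < N.+1%:R :> R by rewrite ltr0n.
have := H N n0N.
have -> : a = (a - b) + b by ring.
rewrite powRD; last by rewrite (gt_eqF N0) implybT.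
rewrite mulrA ler_pM2r ?powR_gt0// mulrC -ler_pdivlMr//.
have : X <= N.+1%:R `^ (a - b).
  have -> : X = (X `^ (a - b)^-1) `^ (a - b) by rewrite -powRrM mulVf ?gt_eqF// powRr1// ltW.
  by apply: ge0_ler_powR; rewrite ?nnegrE ?powR_ge0 ?ltW.
have := ler_norm (D / c); rewrite /X; lra.
Qed.

Variables (M : R -> R[i]) (p1 p2 p3 : \bar R).
Hypotheses (h1 : (1 <= p1)%E) (h2 : (1 <= p2)%E) (h3 : (0 < p3)%E).
Hypotheses (cM : ccontinuous M) (tM : tildeM p1 p2 p3 M).

(** Both scale arguments pass through this estimate. The left side is the [L^p3] size forced on an
    interval of length [2 rho t]; on the right each packet norm contributes [-1] to the exponent,
    whence the [-2]. *)
Lemma packet_inequality : exists2 D : R, 0 <= D & forall t a s d rho : R,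
  0 < t -> 0 < d -> 0 < rho ->
  (forall z, `|z| <= rho * t -> d <= cmod (BM M (packet t a s) (packet t (- a) (- s)) z)) ->
  d * (2 * rho) `^ (einv p3) * t `^ (einv p3) <= D * t `^ (einv p1 + einv p2 - 2).
Proof.
have [_ [K HK]] := tM.
have [K1 K10 H1] := Lpnorm_packet h1; have [K2 K20 H2] := Lpnorm_packet h2.
(* [K] may be negative, while the packet bounds are multiplied as nonnegative quantities; hence
   [|K|]. *)
exists (`|K| * K1 * K2); first by rewrite !mulr_ge0.
move=> t a s d rho t0 d0 rho0 Hz; have tn0 : t != 0 by rewrite gt_eqF.
have L := Lpnorm_lower h3 d0 (mulr_gt0 rho0 t0) Hz.
have U := HK _ _ (classP_packet a s tn0) (classP_packet (- a) (- s) tn0).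
have N0 p f : (0 <= @Lpnorm R p f)%E by exact: Lnorm_ge0.
have : ((d * (2 * (rho * t)) `^ einv p3)%:E <=
   (`|K| * (K1 * t `^ (einv p1 - 1)) * (K2 * t `^ (einv p2 - 1)))%:E)%E.
  apply: le_trans L (le_trans U _); rewrite EFinM (EFinM `|K|).
  apply: (@le_trans _ _ (`|K|%:E * Lpnorm p1 (packet t a s) * Lpnorm p2 (packet t (- a) (- s)))%E).
    apply: lee_wpmul2r => //; apply: lee_wpmul2r => //.
    by rewrite lee_fin ler_norm.
  have n1 := H1 t a s t0; have n2 := H2 t (- a) (- s) t0.
  apply: lee_pmul => //; first by rewrite mule_ge0// lee_fin.
  by apply: lee_wpmul2l => //; rewrite lee_fin.
rewrite lee_fin mulrA powRM ?mulr_ge0 ?(ltW t0) ?(ltW rho0)//.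
rewrite [leLHS]mulrA => H; apply: le_trans H _.
rewrite le_eqVlt; apply/orP; left; apply/eqP.
have -> : t `^ (einv p1 + einv p2 - 2) = t `^ (einv p1 - 1) * t `^ (einv p2 - 1).
  by rewrite -powRD; [congr (t `^ _); ring|rewrite (gt_eqF t0) implybT].
by ring.
Qed.

(** With [t = n + 1] the large-scale lower bound [d t^-2] cancels the [-2] of the packet norms,
    leaving the bare exponents. *)
Lemma first_exponent_inequality (a : R) : M (2 * a) <> 0 -> einv p3 <= einv p1 + einv p2.
Proof.
move=> Ma; have [D D0 HD] := packet_inequality.
have [d [rho [t0 [d0 rho0 t00 Hlow]]]] := BM_large_scale cM Ma.
have c0 : 0 < d * (2 * rho) `^ einv p3 by rewrite mulr_gt0// powR_gt0// mulr_gt0.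
apply: (@powR_growth _ _ _ D (Num.trunc t0) c0) => n nt.
set t : R := n.+1%:R; have tp : 0 < t by rewrite ltr0n.
have tt0 : t0 <= t.
  by apply: ltW; apply: lt_le_trans (truncnS_gt t0) _; rewrite ler_nat ltnS.
have dt : 0 < d * t ^- 2 by rewrite mulr_gt0// invr_gt0 exprn_gt0.
have := HD t a 0 _ rho tp dt rho0 (fun z => Hlow t z tt0).
rewrite powRD; last by rewrite (gt_eqF tp) implybT.
have -> : t `^ (- 2) = t ^- 2 by rewrite powRN powR_mulrn// ltW.
have t2 : 0 < t ^- 2 by rewrite invr_gt0 exprn_gt0.
have -> : d / t ^+ 2 * (2 * rho) `^ einv p3 * t `^ einv p3 =
  d * (2 * rho) `^ einv p3 * t `^ einv p3 * t ^- 2 by ring.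
by rewrite mulrA ler_pM2r.
Qed.

(** With [t = 1 / N] every exponent changes sign, and the lower bound [d N] adds 1: growth in [N]
    compares [1 - 1/p3] with [2 - 1/p1 - 1/p2]. *)
Lemma second_exponent_inequality (s : R) : integ (twistr M s) -> integ (twisti M s) ->
  (rint (twistr M s) != 0) || (rint (twisti M s) != 0) ->
  einv p1 + einv p2 <= einv p3 + 1.
Proof.
move=> ir ii m0; have [D D0 HD] := packet_inequality.
have [d [rho [n0 [d0 rho0 Hlow]]]] := BM_small_scale cM ir ii m0.
have c0 : 0 < d * (2 * rho) `^ einv p3 by rewrite mulr_gt0// powR_gt0// mulr_gt0.
have G : forall n, (n0 <= n)%N ->
   d * (2 * rho) `^ einv p3 * n.+1%:R `^ (1 - einv p3) <= D * n.+1%:R `^ (2 - einv p1 - einv p2).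
  move=> n n0n; set N : R := n.+1%:R; have Np : 0 < N by rewrite ltr0n.
  have tp : 0 < N^-1 by rewrite invr_gt0.
  have := HD N^-1 0 s _ rho tp (mulr_gt0 d0 Np) rho0 (fun z => Hlow n z n0n).
  have E x : N^-1 `^ x = N `^ (- x) by rewrite -powR_inv1 ?(ltW Np)// -powRrM mulN1r.
  rewrite !E powRD; last by rewrite (gt_eqF Np) implybT.
  rewrite powRr1 ?(ltW Np)//.
  have -> : - (einv p1 + einv p2 - 2) = 2 - einv p1 - einv p2 by ring.
  have -> : d * N * (2 * rho) `^ einv p3 * N `^ (- einv p3) =
   d * (2 * rho) `^ einv p3 * (N * N `^ (- einv p3)) by ring.
  by [].
by have := powR_growth c0 G; lra.
Qed.

End Exponents.

(** * A modulation at which the integral of the symbol is nonzero *)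

Section Nonvanishing.
Variable R : realType.
Local Notation leb := (@lebesgue_measure R).
Local Notation rint f := (Rintegral leb setT f).
Local Notation integ f := (leb.-integrable setT (EFin \o f)).

Lemma cintegrable_integ (M : R -> R[i]) : cintegrable M ->
  integ (fun u => complex.Re (M u)) /\ integ (fun u => complex.Im (M u)).
Proof.
move=> [mr [mi fin]].
have ic : integ (fun u => cmod (M u)).
  apply/integrableP; split.
    apply/measurable_EFinP; apply: (@measurableT_comp _ _ _ _ _ _ (@Num.sqrt R)).
      by apply: continuous_measurable_fun; exact: sqrt_continuous.
    by apply: measurable_funD; exact: measurable_funX.
  by under eq_integral do rewrite /= ger0_norm ?sqrtr_ge0//.
split; apply: integ_le ic _ => // u.
  by rewrite /cmod -sqrtr_sqr ler_wsqrtr// lerDl sqr_ge0.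
by rewrite /cmod -sqrtr_sqr ler_wsqrtr// lerDr sqr_ge0.
Qed.

Lemma twist_integ (M : R -> R[i]) s : cintegrable M ->
  integ (twistr M s) /\ integ (twisti M s).
Proof.
move=> /cintegrable_integ [ir ii]; split.
  by apply: integD; [exact: integ_cosl|exact: integ_sinl].
by apply: integB; [exact: integ_cosl|exact: integ_sinl].
Qed.

(** If all twisted integrals vanished, so would the cosine and sine transforms of the real and
    imaginary parts of [M], and [fcfs_eq0] would give [M = 0]. *)
Lemma twist_nonvanishing (M : R -> R[i]) : ccontinuous M -> cintegrable M ->
  M <> (fun=> 0) ->
  exists s, (rint (twistr M s) != 0) || (rint (twisti M s) != 0).
Proof.
move=> [cr ci] iM M0; apply: contrapT => H; apply: M0.
have [ir ii] := cintegrable_integ iM.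
set Mr := (fun u => complex.Re (M u)) in cr ir; set Mi := (fun u => complex.Im (M u)) in ci ii.
have Z s : rint (twistr M s) = 0 /\ rint (twisti M s) = 0.
  split; apply/eqP; apply: contrapT => /negP K; apply: H; exists s; rewrite K ?orbT//.
have Er s : fc Mr s + fs Mi s = 0.
  by rewrite -(Z s).1 rintD//; [exact: integ_cosl|exact: integ_sinl].
have Ei s : fc Mi s - fs Mr s = 0.
  by rewrite -(Z s).2 rintB//; [exact: integ_cosl|exact: integ_sinl].
(* Replacing [s] by [- s] flips only the sine transforms, so adding and subtracting isolates each of
   the four transforms. *)
have ErN s : fc Mr s - fs Mi s = 0 by rewrite -(Er (- s)) fcN fsN.
have EiN s : fc Mi s + fs Mr s = 0 by rewrite -(Ei (- s)) fcN fsN// opprK.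
have Zr : Mr = (fun=> 0).
  apply: fcfs_eq0 => // s.
    by have := Er s; have := ErN s; lra.
  by have := Ei s; have := EiN s; lra.
have Zi : Mi = (fun=> 0).
  apply: fcfs_eq0 => // s.
    by have := Ei s; have := EiN s; lra.
  by have := Er s; have := ErN s; lra.
apply/funext => u; have := congr1 (fun f => f u) Zr; have := congr1 (fun f => f u) Zi.
by rewrite /Mr /Mi; case: (M u) => x y /= -> ->.
Qed.

End Nonvanishing.

Unset Implicit Arguments.

Theorem mainTheorem12 (R : realType) (p1 p2 p3 : \bar R) (M : R -> R[i]) :
  (1 <= p1)%E -> (1 <= p2)%E -> ((0:R)%:E < p3)%E ->
  ccontinuous M -> cintegrable M -> M <> (fun _ => 0) ->
  tildeM p1 p2 p3 M ->
  einv p3 <= einv p1 + einv p2 <= einv p3 + 1.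
Proof.
move=> h1 h2 h3 cM iM M0 tM; apply/andP; split.
  have [u Mu] : exists u, M u <> 0.
    apply: contrapT => H; apply: M0; apply/funext => u.
    by apply: contrapT => Mu; apply: H; exists u.
  (* Packets at frequencies [u / 2] and [- u / 2] see the symbol at their difference [u]. *)
  apply: (@first_exponent_inequality R M p1 p2 p3 h1 h2 h3 cM tM (u / 2)).
  by rewrite mulrC divfK.
have [s ms] := twist_nonvanishing cM iM M0.
have [ir ii] := twist_integ s iM.
exact: (second_exponent_inequality h1 h2 h3 cM tM ir ii ms).
Qed.
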